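(* Let $n\ge1$, let $\lambda=(\lambda_1,\lambda_2,\dots,\lambda_n)$ be a partition of length at most $n$ such that $\lambda_1\ne\lambda_2$, and let $0<a<b$. Put $\eta=(\lambda_1-1,\lambda_1-1,\lambda_2,\dots,\lambda_n)$ (a partition of length at most $n+1$) and $\mu=(\lambda_1-1,\lambda_2,\dots,\lambda_n)$. Then the Chebyshev-Bernstein basis of $\mathcal{E}_\lambda(n)$ over $[a,b]$ satisfies, for $k=0,\dots,n$, $$\frac{dB^n_{k,\lambda}(t)}{dt}=\frac{\binom{\eta}{\lambda}_{n}}{(b-a)\binom{\eta}{\mu}_{n}}\left(G_1(k,n)B^n_{k-1,\mu}(t)+G_2(k,n)B^n_{k,\mu}(t)+G_3(k,n)B^n_{k+1,\mu}(t)\right),$$ where $$G_1(k,n)=(n+1-k)\,a\,\Gamma_\lambda^\eta(n,k)\,R_\eta(k-1,n+1),$$ $$G_2(k,n)=R_\eta(k,n+1)\left((k+1)\,b\,\Delta_\lambda^\eta(n,k)-(n+1-k)\,a\,\Gamma_\lambda^\eta(n,k)\right),$$ $$G_3(k,n)=-(k+1)\,b\,\Delta_\lambda^\eta(n,k)\,R_\eta(k+1,n+1),$$ $(B^n_{k,\mu})_{0\le k\le n}$ is the Chebyshev-Bernstein basis of $\mathcal{E}_\mu(n)$ over $[a,b]$, and $B^n_{-1,\mu}\equiv B^n_{n+1,\mu}\equiv0$ by convention (so the corresponding terms are zero).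
   Context: Partitions and Schur functions: a partition of length at most $n$ is a sequence of integers $\lambda_1\ge\dots\ge\lambda_n\ge0$; partitions differing only by trailing zeros are identified (entries beyond the last are $0$). For a partition $\nu$ of length at most $m$, $S_\nu(u_1,\dots,u_m)=\det(u_i^{\nu_j+m-j})_{1\le i,j\le m}/\det(u_i^{m-j})_{1\le i,j\le m}$ is the Schur polynomial (evaluated also at coinciding arguments). The notation $S_\nu(x^p,y^q)$ means that $x$ is repeated $p$ times and $y$ is repeated $q$ times. $f_\nu(m)=S_\nu(1^m)$ is the number of semi-standard Young tableaux of shape $\nu$ with entries at most $m$; $f_\emptyset(m)=1$. The bottom partition of $\nu=(\nu_1,\nu_2,\dots)$ is $\nu^{(0)}=(\nu_2,\nu_3,\dots)$. Note $\eta^{(0)}=\mu$ and $\mu^{(0)}=\lambda^{(0)}=(\lambda_2,\dots,\lambda_n)$. Müntz space: $\mathcal{E}_\lambda(n)$ is the span on $]0,\infty[$ of $1,t^{\lambda_1-\lambda_2+1},t^{\lambda_1-\lambda_3+2},\dots,t^{\lambda_1-\lambda_n+(n-1)},t^{\lambda_1+n}$. Chebyshev-Bernstein basis $(B^n_{0,\lambda},\dots,B^n_{n,\lambda})$ of $\mathcal{E}_\lambda(n)$ over $[a,b]\subset\,]0,\infty[$: the unique basis of $\mathcal{E}_\lambda(n)$ with $\sum_{k}B^n_{k,\lambda}=1$ such that, for each $k$, $B^n_{k,\lambda}$ vanishes $k$ times at $a$ and $n-k$ times at $b$ (counting multiplicity). Factors: $$\Gamma_\lambda^\eta(n,k)=\frac{S_{\lambda^{(0)}}(a^{n-k},b^k)\,S_\eta(a^{n+2-k},b^k)}{S_\lambda(a^{n+1-k},b^k)\,S_{\eta^{(0)}}(a^{n+1-k},b^k)},\quad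 \Delta_\lambda^\eta(n,k)=\frac{S_{\lambda^{(0)}}(a^{n-k},b^k)\,S_\eta(a^{n-k},b^{k+2})}{S_\lambda(a^{n-k},b^{k+1})\,S_{\eta^{(0)}}(a^{n-k},b^{k+1})},$$ $$R_\eta(k,n+1)=\frac{S_{\mu}(a^{n-k},b^{k+1})\,S_{\mu}(a^{n+1-k},b^k)}{S_\eta(a^{n+1-k},b^{k+1})\,S_{\mu^{(0)}}(a^{n-k},b^k)},$$ and for a partition $\nu$ of length at most $n$, $\displaystyle\binom{\eta}{\nu}_{\!n}=\frac{f_\nu(n+1)\,f_{\eta^{(0)}}(n+1)}{f_{\nu^{(0)}}(n)\,f_\eta(n+2)}$. *)

(* Defs.v *)
From HB Require Import structures.
From mathcomp Require Import all_boot all_order all_algebra.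

Set Implicit Arguments.
Unset Strict Implicit.
Unset Printing Implicit Defensive.

Import Order.TTheory GRing.Theory Num.Theory.
Local Open Scope ring_scope.

(* The notations of mpoly and of the analysis library clash, so mpoly is only
   imported inside this module. *)
Module Schur.
From mathcomp Require Import classical_sets mpoly.

(* The matrix (u_i ^ (nu_j + m - j)), 1 <= i, j <= m; missing parts are 0. *)
Definition alternant (R : idomainType) (m : nat) (nu : seq nat) :
    'M[{mpoly R[m]}]_m :=
  \matrix_(i < m, j < m) 'X_i ^+ (nth 0%N nu j + (m - j.+1)).

(* The exact quotient det(u_i ^ (nu_j + m - j)) / det(u_i ^ (m - j)) in the
   polynomial ring (a domain, and the denominator is nonzero, so there is at
   most one such p); evaluation then makes sense at coinciding arguments. *)
Definition schur_poly (R : idomainType) (m : nat) (nu : seq nat) :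
    {mpoly R[m]} :=
  xget 0 [set p : {mpoly R[m]} |
           \det (alternant R m nu) = p * \det (alternant R m [::])]%classic.

Definition schur (R : idomainType) (nu : seq nat) (u : seq R) : R :=
  (schur_poly R (size u) nu).@[fun i => nth 0 u i].

End Schur.

From mathcomp Require Import all_classical all_reals all_analysis.
Import numFieldNormedType.Exports.
Local Open Scope classical_set_scope.
Local Open Scope ring_scope.

(* A partition of length at most n is an n-tuple of naturals; its i-th part
   (from i = 0) is nth 0 nu i, hence 0 beyond the last entry. *)
Definition is_partition (nu : seq nat) : bool := sorted geq nu.

Definition bottom (nu : seq nat) : seq nat := behead nu.

Definition eta_of (la : seq nat) : seq nat :=
  [:: (head 0 la).-1, (head 0 la).-1 & behead la]%N.

Definition mu_of (la : seq nat) : seq nat :=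
  ((head 0 la).-1 :: behead la)%N.

Section Muntz.
Variable R : realType.
Implicit Types (n : nat) (nu : seq nat) (a b : R).

(* nu_1 - nu_(i+1) + i: it is 0 for i = 0 and, since nu_(n+1) = 0, it is
   nu_1 + n for i = n.  The subtraction is exact because nu is nonincreasing. *)
Definition muntz_exponent nu (i : nat) : nat :=
  (nth 0 nu 0 - nth 0 nu i + i)%N.

(* Only the values on ]0, +oo[ matter. *)
Definition in_muntz n nu (f : R -> R) : Prop :=
  exists c : 'I_n.+1 -> R, forall t, 0 < t ->
    f t = \sum_(i < n.+1) c i * t ^+ muntz_exponent nu i.

Definition is_muntz_basis n nu (B : 'I_n.+1 -> R -> R) : Prop :=
  [/\ forall k, in_muntz n nu (B k),
      forall c : 'I_n.+1 -> R,
        (forall t, 0 < t -> \sum_(k < n.+1) c k * B k t = 0) ->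
        forall k, c k = 0
    & forall f, in_muntz n nu f -> exists c : 'I_n.+1 -> R,
        forall t, 0 < t -> f t = \sum_(k < n.+1) c k * B k t].

(* x is a zero of f of multiplicity at least m. *)
Definition vanishes (m : nat) (f : R -> R) (x : R) : Prop :=
  forall j, (j < m)%N -> derive1n j f x = 0.

Definition is_chebyshev_bernstein n nu a b (B : 'I_n.+1 -> R -> R) : Prop :=
  [/\ is_muntz_basis nu B,
      forall t, 0 < t -> \sum_(k < n.+1) B k t = 1
    & forall k : 'I_n.+1, vanishes k (B k) a /\ vanishes (n - k) (B k) b].

(* B extended by 0 outside the index range 0, ..., n. *)
Definition extend0 n (B : 'I_n.+1 -> R -> R) (j : int) (t : R) : R :=
  if j is Posz m then (if insub m is Some i then B i t else 0) else 0.

End Muntz.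

Section Coefficients.
Variable R : realType.
Implicit Types (n k p q m : nat) (la nu eta : seq nat) (a b : R).

(* S_nu(a^p, b^q) *)
Definition schur2 nu a p b q : R := Schur.schur nu (nseq p a ++ nseq q b).

(* f_nu(m) = S_nu(1^m), as an element of R *)
Definition ssyt_count nu m : R := Schur.schur nu (nseq m 1).

Definition Gamma la eta a b n k : R :=
  (schur2 (bottom la) a (n - k) b k * schur2 eta a (n + 2 - k) b k) /
  (schur2 la a (n + 1 - k) b k * schur2 (bottom eta) a (n + 1 - k) b k).

Definition Delta la eta a b n k : R :=
  (schur2 (bottom la) a (n - k) b k * schur2 eta a (n - k) b (k + 2)) /
  (schur2 la a (n - k) b (k + 1) * schur2 (bottom eta) a (n - k) b (k + 1)).

(* R_eta(k, n+1), with mu = bottom eta *)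
Definition Rfactor eta a b n k : R :=
  let mu := bottom eta in
  (schur2 mu a (n - k) b (k + 1) * schur2 mu a (n + 1 - k) b k) /
  (schur2 eta a (n + 1 - k) b (k + 1) * schur2 (bottom mu) a (n - k) b k).

Definition part_binomial eta nu n : R :=
  (ssyt_count nu (n + 1) * ssyt_count (bottom eta) (n + 1)) /
  (ssyt_count (bottom nu) n * ssyt_count eta (n + 2)).

(* Here k <= n.  The truncated subtractions are exact except in the factor
   R_eta of G1 for k = 0 and of G3 for k = n; there the value is irrelevant, as
   the coefficient multiplies the zero function B_(-1) or B_(n+1). *)
Definition G1 la eta a b n k : R :=
  (n + 1 - k)%:R * a * Gamma la eta a b n k * Rfactor eta a b n (k - 1).

Definition G2 la eta a b n k : R :=
  Rfactor eta a b n k *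
  ((k + 1)%:R * b * Delta la eta a b n k -
   (n + 1 - k)%:R * a * Gamma la eta a b n k).

Definition G3 la eta a b n k : R :=
  - ((k + 1)%:R * b * Delta la eta a b n k * Rfactor eta a b n (k + 1)).

End Coefficients.

(* Main.v *)
Require Import Defs.
From mathcomp Require Import all_boot all_order all_algebra.
From mathcomp Require Import perm zify ring lra.
From mathcomp Require classical_sets mpoly.

Set Implicit Arguments.
Unset Strict Implicit.
Unset Printing Implicit Defensive.
Import Order.TTheory GRing.Theory Num.Theory.
Local Open Scope ring_scope.

(** Put [D := la_1 + n].  The substitution [t = ab/s], followed by
    multiplication by [s^D], turns the Muntz space of [la] into the span of the
    powers [s^(la_j + n + 1 - j)], [1 <= j <= n + 1]: these are the exponents of
    the alternant defining [S_la] in [n + 1] variables, and the constant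
    function 1 becomes the top power [s^D].  Passing from [la] to [mu] only
    lowers the top exponent to [D - 1]; the [n] lower exponents, those of
    [S_(bottom la)] in [n] variables, are shared.  The operator [t d/dt] becomes
    [D - s d/ds], which annihilates [s^D], and [B_k] becomes a polynomial
    [P_k = (s - a)^(n-k) (s - b)^k g_k].  The theorem is then an identity between
    polynomials ([derivative_identity]).

    Schur functions at repeated arguments are handled without any limit: by
    Newton interpolation the alternant factors as a Vandermonde matrix times a
    matrix of divided differences, so a Schur function is the determinant of
    the divided differences of the powers ([schurE]), and divided differences
    make sense at coinciding nodes.  This gives symmetry, homogeneity, a
    branching rule and hence positivity at positive arguments ([gschur_gt0]).
    It also gives Cramer's rule in the following form ([span_factor]): if
    [f = (s - u_1)...(s - u_n) g] is spanned by the [n] lower powers and a top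
    power with coefficient [c], then [S_low(u) g(x) = c S_top(u, x)], where
    [S_low] has the lower exponents and [S_top] all of them.  So [f] is
    determined by [c], and its leading coefficients at the nodes are quotients
    of Schur functions.

    The partition of unity fixes the top coefficients.  Apply the operator to
    the sum of all [P_k], which is [s^D]: the sum of the images is 0, so the
    partial sum over [j <= k] vanishes to order [n - k - 1] at [a] and to order
    [k] at [b].  Such an element of the lower span is unique up to a factor, so
    its leading coefficients at [a] and [b] are proportional
    ([two_point]), which links [P_k] to [P_(k+1)]
    ([adjacent_leads]).  Solving the recurrence gives closed forms for
    the leading and top coefficients ([lead_a], [lead_b], [lead_kap]).

    Finally, the difference of the two sides of the identity lies in the span
    for [mu].  Its leading terms at [a] and [b] cancel ([coef_next_lead],
    [coef_prev_lead]), so it has [n] zeros; its top coefficient vanishes by a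
    quadratic relation between Schur functions ([top_coef_eq0], from
    [schur_exchange]).  It thus lies in the [n]-dimensional lower span and has
    [n] positive zeros, hence is 0. *)

(** * Divided differences and their determinants *)

Section DividedDifferences.
Variable A : idomainType.
Implicit Types (x c : A) (u v w : seq A) (f g : {poly A}).

Definition quotXsubC x f : {poly A} := Pdiv.CommonRing.rdivp f ('X - x%:P).

Lemma quotXsubC_unique x c f g : f = c%:P + g * ('X - x%:P) -> quotXsubC x f = g.
Proof.
move=> ->; rewrite /quotXsubC addrC Pdiv.RingMonic.rdivp_addl_mul_small //.
  exact: monicXsubC.
by rewrite size_XsubC ltnS size_polyC leq_b1.
Qed.

Lemma quotXsubCE x f : f = f.[x]%:P + quotXsubC x f * ('X - x%:P).
Proof.
have /factor_theorem [q Eq] : root (f - f.[x]%:P) x.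
  by rewrite rootE !hornerE subrr.
have E : f = f.[x]%:P + q * ('X - x%:P) by rewrite -Eq addrC subrK.
by rewrite (quotXsubC_unique E).
Qed.

Lemma quotXsubCD x f g : quotXsubC x (f + g) = quotXsubC x f + quotXsubC x g.
Proof.
apply: (@quotXsubC_unique _ (f.[x] + g.[x])).
by rewrite {1}(quotXsubCE x f) {1}(quotXsubCE x g) polyCD; ring.
Qed.

Lemma quotXsubCZ x c f : quotXsubC x (c *: f) = c *: quotXsubC x f.
Proof.
apply: (@quotXsubC_unique _ (c * f.[x])).
by rewrite {1}(quotXsubCE x f) scalerDr scale_polyC scalerAl.
Qed.

Lemma quotXsubC_mul x g : quotXsubC x (('X - x%:P) * g) = g.
Proof. by apply: (@quotXsubC_unique _ 0); rewrite polyC0 add0r mulrC. Qed.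

Lemma quotXsubC_Xn x e : quotXsubC x 'X^e = \sum_(s < e) x ^+ (e.-1 - s) *: 'X^s.
Proof.
apply: (@quotXsubC_unique _ (x ^+ e)).
rewrite polyC_exp [_ * ('X - _)]mulrC.
have <- : 'X^e - x%:P ^+ e =
  ('X - x%:P) * (\sum_(i < e) (x ^+ (e.-1 - i) *: 'X^i)).
  rewrite -opprB subrXX -mulNr opprB; congr (_ * _); apply: eq_bigr => i _.
  by rewrite -polyC_exp mul_polyC.
by rewrite addrC subrK.
Qed.

(** Newton's divided difference of [f] at the first [i + 1] entries of [u].
    Dividing by [X - x] repeatedly, instead of dividing by differences of nodes,
    makes it meaningful over a domain and at repeated nodes. *)
Fixpoint divdiff u i f : A :=
  match u, i with
  | [::], _ => 0
  | x :: _, 0 => f.[x]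
  | x :: u', j.+1 => divdiff u' j (quotXsubC x f)
  end.

Lemma divdiffD u i f g : divdiff u i (f + g) = divdiff u i f + divdiff u i g.
Proof.
elim: u i f g => [|x u IH] [|i] f g /=; rewrite ?addr0 //.
  by rewrite hornerD.
by rewrite quotXsubCD IH.
Qed.

Lemma divdiffZ u i c f : divdiff u i (c *: f) = c * divdiff u i f.
Proof.
elim: u i f => [|x u IH] [|i] f /=; rewrite ?mulr0 //.
  by rewrite hornerZ.
by rewrite quotXsubCZ IH.
Qed.

Lemma divdiff0 u i : divdiff u i 0 = 0.
Proof. by rewrite -(scale0r (0 : {poly A})) divdiffZ mul0r. Qed.

Lemma divdiff_sum u i (I : Type) (r : seq I) (P : pred I) (F : I -> {poly A}) :
  divdiff u i (\sum_(j <- r | P j) F j) = \sum_(j <- r | P j) divdiff u i (F j).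
Proof. exact: (big_morph _ (divdiffD u i) (divdiff0 u i)). Qed.

Lemma divdiff_rcons u x i f : (i < size u)%N -> divdiff (rcons u x) i f =
  divdiff u i f.
Proof. by elim: u i f => [|y u IH] [|i] f //= ?; apply: IH. Qed.

Lemma divdiff_prod_lt u v i g : (i < size u)%N ->
  divdiff (u ++ v) i (\prod_(y <- u) ('X - y%:P) * g) = 0.
Proof.
elim: u i => [|y u IH] [|i] //=; rewrite big_cons => lti.
  by rewrite !hornerE subrr !mul0r.
by rewrite -mulrA quotXsubC_mul IH.
Qed.

Lemma divdiff_prod u v i g :
  divdiff (u ++ v) (size u + i) (\prod_(y <- u) ('X - y%:P) * g) = divdiff v i g.
Proof.
elim: u => [|y u IH] /=; first by rewrite big_nil mul1r.
by rewrite big_cons -mulrA quotXsubC_mul IH.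
Qed.

(** Newton interpolation: the recursion on [u] peels off one factor [X - x]. *)
Lemma newton u f : exists g,
  f = \sum_(i < size u) divdiff u i f *: \prod_(y <- take i u) ('X - y%:P)
      + \prod_(y <- u) ('X - y%:P) * g.
Proof.
elim: u f => [|x u IH] f.
  by exists f; rewrite big_ord0 big_nil mul1r add0r.
have [g Eg] := IH (quotXsubC x f); exists g => /=.
rewrite big_ord_recl /= big_nil big_cons [LHS](quotXsubCE x) -addrA alg_polyC.
congr (_ + _); rewrite {1}Eg mulrDl mulr_suml; congr (_ + _).
  by apply: eq_bigr => i _; rewrite big_cons -scalerAl mulrC.
by rewrite mulrC mulrA.
Qed.

(** A divided difference of top order only sees the leading coefficient. *)
Lemma divdiff_coef u i f : (i < size u)%N -> (size f <= i.+1)%N ->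
  divdiff u i f = f`_i.
Proof.
elim: u i f => [|x u IH] [|i] f //= lti szf.
  by rewrite (size1_polyC szf) hornerC coefC.
have szq : (size (quotXsubC x f) <= i.+1)%N.
  have [->|q0] := eqVneq (quotXsubC x f) 0; first by rewrite size_poly0.
  rewrite -ltnS; apply: leq_trans szf.
  have szM : size (quotXsubC x f * ('X - x%:P)) = (size (quotXsubC x f)).+1.
    by rewrite (size_Mmonic q0 (monicXsubC x)) size_XsubC addn2.
  rewrite -szM [in leqRHS](quotXsubCE x f) [_%:P + _ * _]addrC size_polyDl // szM.
  by rewrite (leq_ltn_trans (size_polyC_leq1 _)) // ltnS size_poly_gt0.
rewrite IH // [in RHS](quotXsubCE x f) coefD coefC /= add0r mulrBr coefB coefMX.
by rewrite coefMC /= (nth_default 0 szq) mul0r subr0.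
Qed.

Definition divdiff_det m u (fs : nat -> {poly A}) : A :=
  \det (\matrix_(i < m, j < m) divdiff u i (fs j)).

Lemma eq_divdiff_det m u v fs gs :
    (forall i j : nat, (i < m)%N -> (j < m)%N -> divdiff u i (fs j) =
      divdiff v i (gs j)) ->
  divdiff_det m u fs = divdiff_det m v gs.
Proof.
by move=> E; congr (\det _); apply/matrixP => i j; rewrite !mxE; apply: E.
Qed.

Lemma prod_subr0 x u : x \in u -> \prod_(y <- u) (x - y) = 0.
Proof.
by move=> xu; apply/eqP; rewrite prodf_seq_eq0; apply/hasP; exists x => //=;
  rewrite subrr.
Qed.

(** Newton's formula at the nodes themselves writes the matrix of values as a
    lower triangular matrix times the matrix of divided differences, the
    remainder term being 0 there. *)
Lemma det_horner m u (fs : nat -> {poly A}) : size u = m ->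
  \det (\matrix_(i < m, j < m) (fs j).[nth 0 u i]) =
  \prod_(i < m) \prod_(y <- take i u) (nth 0 u i - y) * divdiff_det m u fs.
Proof.
move=> <-; pose L : 'M[A]_(size u) :=
  \matrix_(i, k) \prod_(y <- take k u) (nth 0 u i - y).
have Ltrig : is_trig_mx L.
  apply/is_trig_mxP => i j ltij; rewrite mxE.
  apply: prod_subr0.
  by apply/(nthP 0); exists i; rewrite ?nth_take // size_take ltn_ord.
have <- : \det L = \prod_(i < size u) \prod_(y <- take i u) (nth 0 u i - y).
  by rewrite det_trig //; apply: eq_bigr => i _; rewrite mxE.
rewrite /divdiff_det -det_mulmx; congr (\det _); apply/matrixP => i j;
  rewrite !mxE.
have [g {1}->] := newton u (fs j).
rewrite hornerD hornerM horner_prod.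
have -> : \prod_(y <- u) ('X - y%:P).[nth 0 u i] = 0.
  rewrite -[RHS](prod_subr0 (mem_nth 0 (ltn_ord i))).
  by apply: eq_bigr => y _; rewrite !hornerE.
rewrite mul0r addr0 horner_sum; apply: eq_bigr => k _.
rewrite !mxE hornerZ horner_prod mulrC; congr (_ * _).
by apply: eq_bigr => y _; rewrite !hornerE.
Qed.

Lemma divdiff_det_Xn m u : size u = m -> divdiff_det m u (fun j => 'X^j) = 1.
Proof.
move=> <-; rewrite /divdiff_det -det_tr det_trig.
  apply: big1 => i _; rewrite !mxE divdiff_coef //; last by rewrite size_polyXn.
  by rewrite coefXn eqxx.
apply/is_trig_mxP => i j ltij;
  rewrite !mxE divdiff_coef // ?size_polyXn ?ltnS 1?ltnW //.
by rewrite coefXn gtn_eqF.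
Qed.

(** The Schur function with increasing strict exponents [e 0 < ... < e (m - 1)];
    see [schurE] for the dictionary with partitions. *)
Definition gschur m u (e : nat -> nat) : A := divdiff_det m u (fun j => 'X^(e j)).

Lemma eq_gschur m u e1 e2 :
  (forall j, (j < m)%N -> e1 j = e2 j) -> gschur m u e1 = gschur m u e2.
Proof. by move=> E; apply: eq_divdiff_det => i j _ ltj; rewrite E. Qed.

End DividedDifferences.

Lemma map_quotXsubC (A A' : idomainType) (phi : {rmorphism A -> A'}) x f :
  map_poly phi (quotXsubC x f) = quotXsubC (phi x) (map_poly phi f).
Proof.
apply/esym/(@quotXsubC_unique _ _ (phi f.[x])).
by rewrite {1}(quotXsubCE x f) rmorphD rmorphM /= map_polyXsubC map_polyC.
Qed.

Lemma map_divdiff (A A' : idomainType) (phi : {rmorphism A -> A'}) u i f :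
  phi (divdiff u i f) = divdiff (map phi u) i (map_poly phi f).
Proof.
elim: u i f => [|x u IH] [|i] f /=; rewrite ?rmorph0 ?horner_map //.
by rewrite IH map_quotXsubC.
Qed.

Lemma map_gschur (A A' : idomainType) (phi : {rmorphism A -> A'}) m u e :
  phi (gschur m u e) = gschur m (map phi u) e.
Proof.
rewrite /gschur /divdiff_det -det_map_mx; congr (\det _); apply/matrixP => i j.
by rewrite !mxE map_divdiff map_polyXn.
Qed.

Lemma vandermonde_neq0 (A : idomainType) (u : seq A) : uniq u ->
  \prod_(i < size u) \prod_(y <- take i u) (nth 0 u i - y) != 0.
Proof.
move=> Uu; apply/prodf_neq0 => i _; rewrite prodf_seq_neq0.
apply/allP => y /= yt; rewrite subr_eq0; apply/eqP => E.
have : uniq (rcons (take i u) (nth 0 u i)) by rewrite -take_nth ?take_uniq.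
by rewrite rcons_uniq E yt.
Qed.

(** For distinct nodes both determinants of values change by the sign of the
    permutation, for the powers [X^(e j)] and for the powers [X^j], so the
    quotient is unchanged. *)
Lemma gschur_perm_uniq (A : idomainType) m (u : m.-tuple A) (v : seq A) e :
  uniq u -> perm_eq v u -> gschur m v e = gschur m u e.
Proof.
move=> Uu puv; have szv : size v = m by rewrite (perm_size puv) size_tuple.
have /vandermonde_neq0 Vn0 : uniq v by rewrite (perm_uniq puv).
rewrite szv in Vn0.
have [s Es] := tuple_permP puv.
have perm_det (fs : nat -> {poly A}) :
    \det (\matrix_(i < m, j < m) (fs j).[nth 0 v i]) =
    (-1) ^+ s * \det (\matrix_(i < m, j < m) (fs j).[nth 0 u i]).
  rewrite -det_perm -det_mulmx -row_permE; congr (\det _).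
  apply/matrixP => i j; rewrite !mxE Es -tnth_nth tnth_mktuple.
  by rewrite (tnth_nth 0).
have := perm_det (fun j => 'X^(e j)).
rewrite !(det_horner (fun j => 'X^(e j))) ?size_tuple //.
have := perm_det (fun j => 'X^j).
rewrite !(det_horner (fun j =>
  'X^j)) ?size_tuple // !divdiff_det_Xn ?size_tuple //.
rewrite !mulr1 => E2 E1; apply: (mulfI Vn0); apply: etrans E1 _.
by rewrite mulrA -E2.
Qed.

(** * Schur functions as determinants of divided differences *)

Module SchurDet.
Import classical_sets mpoly Schur.

Section Bridge.
Variable R : idomainType.
Implicit Types (nu : seq nat) (u v : seq R).

Definition vars m : m.-tuple {mpoly R[m]} := [tuple 'X_i | i < m].

Lemma vars_uniq m : uniq (vars m).
Proof.
rewrite map_inj_uniq ?enum_uniq // => i j /(congr1 (mcoeff U_(i))).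
rewrite !mcoeffXU eqxx; case: eqVneq => // _ /eqP.
by rewrite oner_eq0.
Qed.

Lemma nth_vars m (i : 'I_m) : nth 0 (vars m) i = 'X_i.
Proof. by rewrite -tnth_nth tnth_mktuple. Qed.

Lemma meval_vars u :
  map (meval (fun i : 'I_(size u) => nth 0 u i)) (vars (size u)) = u.
Proof.
apply: (@eq_from_nth _ 0) => [|i]; rewrite size_map size_tuple // => lti.
by rewrite (nth_map 0) ?size_tuple // (nth_vars (Ordinal lti)) mevalXU.
Qed.

(** Parts are read backwards so that the exponents increase. *)
Definition strict_exp m nu j := (nth 0 nu (m - j.+1) + j)%N.

Lemma det_alternantE m nu : \det (alternant R m nu) =
  (-1) ^+ perm (@rev_ord_inj m) *
  (\prod_(i < m) \prod_(y <- take i (vars m)) (nth 0 (vars m) i - y)) *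
  gschur m (vars m) (strict_exp m nu).
Proof.
rewrite -mulrA /gschur -det_horner ?size_tuple // -det_perm mulrC -det_mulmx.
rewrite -[perm _]invgK -col_permE; congr (\det _); apply/matrixP => i j.
rewrite !mxE nth_vars hornerXn /strict_exp; congr (_ ^+ _).
have -> : (perm (@rev_ord_inj m))^-1%g j = rev_ord j.
  by apply: (canLR (permK _)); rewrite permE rev_ordK.
by rewrite /= subnSK // subKn // ltnW.
Qed.

Lemma gschur_nil m : gschur m (vars m) (strict_exp m [::]) = 1.
Proof.
rewrite -[RHS](divdiff_det_Xn (size_tuple (vars m)));
  apply: (@eq_gschur _ _ _ _ id) => j _.
by rewrite /strict_exp nth_nil.
Qed.

(** The columns of the alternants are reversed on both sides, so the signs
    cancel; the unit exponents give determinant 1 by [divdiff_det_Xn]. *)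
Lemma det_alternant m nu :
  \det (alternant R m nu) =
  gschur m (vars m) (strict_exp m nu) * \det (alternant R m [::]).
Proof. by rewrite !det_alternantE gschur_nil mulr1 mulrC. Qed.

Lemma alternant_nil_neq0 m : \det (alternant R m [::]) != 0.
Proof.
rewrite det_alternantE gschur_nil mulr1 mulf_neq0 ?signr_eq0 //.
by have := vandermonde_neq0 (vars_uniq m); rewrite size_tuple.
Qed.

(** The defining equation holds for the determinant of divided differences at
    the generic point, where it determines the quotient; evaluation commutes
    with divided differences, hence the formula at all arguments. *)
Lemma schurE nu u :
  schur nu u = gschur (size u) u (strict_exp (size u) nu).
Proof.
rewrite /schur; have -> : schur_poly R (size u) nu =
    gschur (size u) (vars (size u)) (strict_exp (size u) nu).
  rewrite /schur_poly; case: xgetP => [p _ /= | /(_ _ (det_alternant _ _)) //].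
  by rewrite det_alternant => /(mulIf (alternant_nil_neq0 _)) ->.
by rewrite map_gschur meval_vars.
Qed.

(** Specialisation of the generic case, so that nodes may coincide. *)
Lemma gschur_perm m u v e : size u = m -> perm_eq v u ->
  gschur m v e = gschur m u e.
Proof.
move=> szu pvu; subst m.
pose ev : {rmorphism {mpoly R[size u]} -> R} := meval (fun i => nth 0 u i).
have [s Es] := @tuple_permP _ _ v (in_tuple u) pvu.
have -> : v = map ev [tuple tnth (vars (size u)) (s i) | i < size u].
  rewrite Es -map_comp; apply: eq_map => i /=.
  by rewrite tnth_mktuple mevalXU (tnth_nth 0).
rewrite -[X in _ = gschur _ X _](meval_vars u) -!map_gschur; congr (ev _).
apply: gschur_perm_uniq.
  exact: vars_uniq.
by apply/tuple_permP; exists s.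
Qed.

End Bridge.
End SchurDet.

(** * Cramer's rule along the last column *)

(** Finite sequences are functions on [nat] read below their length, so that
    adding an exponent or a column needs no cast. *)
Definition snocf (T : Type) m (h : nat -> T) (x : T) j :=
  if (j < m)%N then h j else x.

Section LastColumn.
Variable A : idomainType.
Implicit Types (u w : seq A) (f g : {poly A}) (fs : nat -> {poly A}).

(** The determinant as a functional of its last column; the cofactors do not
    involve that column. *)
Lemma divdiff_det_last_expand m u fs : exists C : 'I_m.+1 -> A,
  C ord_max = divdiff_det m u fs /\
  forall f, divdiff_det m.+1 u (snocf m fs f) =
    \sum_(i < m.+1) divdiff u i f * C i.
Proof.
exists (cofactor (\matrix_(i < m.+1,
  j < m.+1) divdiff u i (snocf m fs 0 j)) ^~ ord_max); split.
  rewrite /cofactor /= -signr_odd oddD addbb mul1r; congr (\det _).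
  by apply/matrixP => i j; rewrite !mxE !lift_max /snocf ltn_ord.
move=> f; rewrite /divdiff_det (expand_det_col _ ord_max); apply: eq_bigr => i _.
rewrite !mxE /snocf /= ltnn; congr (_ * _); congr (_ * \det _).
by apply/matrixP => k j; rewrite !mxE !lift_max ltn_ord.
Qed.

(** All the divided differences of the last column vanish but the last one. *)
Lemma divdiff_det_last_prod m w x fs g : size w = m ->
  divdiff_det m.+1 (rcons w x) (snocf m fs (\prod_(y <- w) ('X - y%:P) * g)) =
  divdiff_det m w fs * g.[x].
Proof.
move=> szw; have [C [Cm ->]] := divdiff_det_last_expand m (rcons w x) fs.
have -> : divdiff_det m w fs = C ord_max.
  by rewrite Cm; apply: eq_divdiff_det => i j lti _; rewrite divdiff_rcons ?szw.
rewrite big_ord_recr /= big1 ?add0r => [|i _].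
  by rewrite -cats1 -{1}szw -[X in divdiff _ X _]addn0 divdiff_prod /= mulrC.
by rewrite -cats1 divdiff_prod_lt ?mul0r ?szw.
Qed.

Lemma divdiff_det_lastD m u fs f g :
  divdiff_det m.+1 u (snocf m fs (f + g)) =
  divdiff_det m.+1 u (snocf m fs f) + divdiff_det m.+1 u (snocf m fs g).
Proof.
have [C [_ E]] := divdiff_det_last_expand m u fs; rewrite !E -big_split /=.
by apply: eq_bigr => i _; rewrite divdiffD mulrDl.
Qed.

Lemma divdiff_det_lastZ m u fs c f :
  divdiff_det m.+1 u (snocf m fs (c *: f)) =
    c * divdiff_det m.+1 u (snocf m fs f).
Proof.
have [C [_ E]] := divdiff_det_last_expand m u fs; rewrite !E mulr_sumr.
by apply: eq_bigr => i _; rewrite divdiffZ mulrA.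
Qed.

Lemma divdiff_det_last_dup m u fs k : (k < m)%N ->
  divdiff_det m.+1 u (snocf m fs (fs k)) = 0.
Proof.
move=> ltkm; rewrite /divdiff_det -det_tr.
apply: (@determinant_alternate _ _ _ (Ordinal (ltnW ltkm : (k < m.+1)%N))
  ord_max).
  by rewrite -val_eqE /= neq_ltn ltkm.
by move=> i; rewrite !mxE /snocf /= ltkm ltnn.
Qed.

Lemma divdiff_det_last_comb m u fs (c : nat -> A) :
  divdiff_det m.+1 u (snocf m fs (\sum_(j < m) c j *: fs j)) = 0.
Proof.
have -> := big_morph (fun f => divdiff_det m.+1 u (snocf m fs f))
  (id1 := 0) (op1 := +%R) (divdiff_det_lastD m u fs).
  by apply: big1 => j _; rewrite divdiff_det_lastZ divdiff_det_last_dup ?mulr0.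
by rewrite -(scale0r (0 : {poly A})) divdiff_det_lastZ mul0r.
Qed.

Lemma divdiff_det_snocf m u (d : nat -> nat) D :
  divdiff_det m.+1 u (snocf m (fun j => 'X^(d j)) 'X^D) =
    gschur m.+1 u (snocf m d D).
Proof. by apply: eq_divdiff_det => i j _ _; rewrite /snocf; case: ifP. Qed.

Definition in_span m (e : nat -> nat) f :=
  exists c : nat -> A, f = \sum_(j < m) c j *: 'X^(e j).

(** Cramer's rule: the determinant with last column [f] can be computed from the
    zeros of [f], or from its expansion, where only the powers outside the span
    survive.  Two outer powers are allowed because both the space of [la] and
    that of [mu] occur in [schur_exchange]. *)
Lemma span_factor m w x (d : nat -> nat) D D' r c c' f g : size w = m ->
  in_span m d r -> f = r + c *: 'X^D + c' *: 'X^D' ->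
  f = \prod_(y <- w) ('X - y%:P) * g ->
  gschur m w d * g.[x] = c * gschur m.+1 (rcons w x) (snocf m d D)
                       + c' * gschur m.+1 (rcons w x) (snocf m d D').
Proof.
move=> szw [b Er] Ef Eg.
have := divdiff_det_last_prod x (fun j => 'X^(d j)) g szw.
rewrite -Eg Ef Er !divdiff_det_lastD !divdiff_det_lastZ divdiff_det_last_comb
  add0r.
by rewrite !divdiff_det_snocf => ->.
Qed.

Lemma in_spanD m e f g : in_span m e f -> in_span m e g -> in_span m e (f + g).
Proof.
move=> [c ->] [b ->]; exists (fun j => c j + b j).
by rewrite -big_split; apply: eq_bigr => j _; rewrite scalerDl.
Qed.

Lemma in_spanZ m e c f : in_span m e f -> in_span m e (c *: f).
Proof.
move=> [b ->]; exists (fun j => c * b j).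
by rewrite scaler_sumr; apply: eq_bigr => j _; rewrite scalerA.
Qed.

Lemma in_span0 m e : in_span m e 0.
Proof. by exists (fun=> 0); rewrite big1 // => j _; rewrite scale0r. Qed.

Lemma in_spanN m e f : in_span m e f -> in_span m e (- f).
Proof. by rewrite -scaleN1r; apply: in_spanZ. Qed.

Lemma in_span_sum m e (I : Type) (r : seq I) (P : pred I) (F : I -> {poly A}) :
  (forall i, P i -> in_span m e (F i)) -> in_span m e (\sum_(i <- r | P i) F i).
Proof.
move=> H; apply: (big_ind (in_span m e)) => //; first exact: in_span0.
exact: in_spanD.
Qed.

End LastColumn.

(** * Homogeneity *)

Section Homogeneity.
Variable A : idomainType.
Implicit Types (u : seq A) (c : A).

Lemma quotXsubC_scale x c f : quotXsubC x (f \Po (c *: 'X)) =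
  c *: (quotXsubC (c * x) f \Po (c *: 'X)).
Proof.
apply: (@quotXsubC_unique _ _ f.[c * x]).
rewrite {1}(quotXsubCE (c * x) f) comp_polyD comp_polyC comp_polyM comp_polyB.
rewrite comp_polyX comp_polyC -scalerAl scalerAr scalerBr.
by rewrite -[c *: x%:P]mul_polyC -polyCM.
Qed.

Lemma divdiff_scale u c i f : divdiff u i (f \Po (c *: 'X)) =
  c ^+ i * divdiff (map ( *%R c) u) i f.
Proof.
elim: u i f => [|x u IH] [|i] f /=; rewrite ?mulr0 //.
  by rewrite horner_comp hornerZ hornerX mul1r.
by rewrite quotXsubC_scale divdiffZ IH exprS mulrA.
Qed.

(** The factor on the left is due to row [i], a divided difference of order [i],
    being homogeneous of degree [e j - i]. *)
Lemma gschur_scale m u c e :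
  c ^+ (\sum_(i < m) i) * gschur m (map ( *%R c) u) e =
  c ^+ (\sum_(j < m) e j) * gschur m u e.
Proof.
have E i j : c ^+ i * divdiff (map ( *%R c) u) i 'X^(e j) =
  divdiff u i 'X^(e j) * c ^+ e j.
  by rewrite -divdiff_scale comp_Xn_poly exprZn divdiffZ mulrC.
pose G v := \matrix_(i < m, j < m) divdiff v i 'X^(e j).
have -> : c ^+ (\sum_(i < m) i) = \det (diag_mx (\row_(i < m) c ^+ i)).
  by rewrite det_diag -prodrXr; apply: eq_bigr => i _; rewrite mxE.
have -> : c ^+ (\sum_(j < m) e j) = \det (diag_mx (\row_(i < m) c ^+ e i)).
  by rewrite det_diag -prodrXr; apply: eq_bigr => i _; rewrite mxE.
rewrite [RHS]mulrC /gschur /divdiff_det -!det_mulmx; congr (\det _).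
by apply/matrixP => i j; rewrite mul_diag_mx mul_mx_diag !mxE E.
Qed.

End Homogeneity.

(** * Branching and positivity *)

Section Positivity.

(** Multilinearity in all the rows at once. *)
Lemma det_sum_rows (A : comNzRingType) m N (G : 'I_m -> 'I_N -> 'I_m -> A) :
  \det (\matrix_(i, j) \sum_k G i k j) =
  \sum_(h : {ffun 'I_m -> 'I_N}) \det (\matrix_(i, j) G i (h i) j).
Proof.
rewrite /determinant exchange_big /=; apply: eq_bigr => s _.
rewrite -mulr_sumr; congr (_ * _).
under eq_bigr do rewrite mxE.
rewrite bigA_distr_bigA; apply: eq_bigr => h _; apply: eq_bigr => i _.
by rewrite mxE.
Qed.

Variable R : realFieldType.
Implicit Types (u : seq R).

Lemma le_exp_last m (e : nat -> nat) j :
  (forall j, j < m -> e j < e j.+1)%N -> (j < m)%N -> (e j.+1 <= e m)%N.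
Proof.
move=> inc ltjm; rewrite -(subnKC ltjm).
have : (j.+1 + (m - j.+1) <= m)%N by rewrite subnKC.
elim: (m - j.+1)%N => [|k IH]; first by rewrite addn0.
by rewrite addnS => lt; apply: leq_trans (IH (ltnW lt)) (ltnW (inc _ lt)).
Qed.

Lemma quotXsubC_binomial x k l N : (k < l <= N)%N ->
  quotXsubC x ('X^l - x ^+ (l - k) *: 'X^k : {poly R}) =
  \sum_(s < N) (if (k <= s < l)%N then x ^+ (l - s.+1) else 0) *: 'X^s.
Proof.
move=> /andP [ltkl lelN].
have -> : 'X^l - x ^+ (l - k) *: 'X^k =
  'X^k * ('X^(l - k) - x ^+ (l - k) *: (1 : {poly R})).
  by rewrite mulrBr -exprD subnKC ?(ltnW ltkl) // -scalerAr mulr1.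
have -> : 'X^(l - k) - x ^+ (l - k) *: (1 : {poly R}) =
  ('X - x%:P) * quotXsubC x 'X^(l - k).
  by rewrite {1}(quotXsubCE x 'X^(l - k)) hornerXn alg_polyC addrC addKr mulrC.
rewrite mulrCA quotXsubC_mul quotXsubC_Xn.
rewrite -(poly_def _ (fun s => x ^+ ((l - k).-1 - s))).
rewrite -(poly_def _ (fun s => if (k <= s < l)%N then x ^+ (l - s.+1) else 0)).
apply/polyP => s; rewrite coefXnM !coef_poly.
case: (leqP k s) => [leks|ltsk] /=; last by case: ifP.
have -> : (s - k < l - k)%N = (s < l)%N by lia.
case: (ltnP s l) => [ltsl|_]; last by rewrite if_same.
by rewrite (leq_trans ltsl lelN); congr (_ ^+ _); lia.
Qed.

(** The branching rule: the interlacing condition comes from subtracting from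
    each column a multiple of the previous one, so as to clear the first row;
    dividing the new columns by [X - x] leaves sums of consecutive powers. *)
Lemma gschur_branch m x u e : (forall j, j < m -> e j < e j.+1)%N ->
  gschur m.+1 (x :: u) e = x ^+ e 0%N *
   \sum_(h : {ffun 'I_m -> 'I_(e m)} | [forall j : 'I_m, e j <= h j < e j.+1]%N)
     (\prod_(j < m) x ^+ (e j.+1 - (h j).+1)) *
     gschur m u (fun j => oapp (fun i => h i : nat) 0%N (insub j)).
Proof.
move=> inc.
(* Column operations clearing the first row, except for its first entry. *)
pose g j : {poly R} :=
  if j is j'.+1 then 'X^(e j) - x ^+ (e j - e j') *: 'X^(e j') else 'X^(e 0%N).
pose c (j k : nat) := if (e j <= k < e j.+1)%N then x ^+ (e j.+1 - k.+1) else 0.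
have -> : gschur m.+1 (x :: u) e = divdiff_det m.+1 (x :: u) g.
  (* The column operations amount to a unitriangular matrix. *)
  pose U : 'M[R]_m.+1 := \matrix_(i, j)
    ((i == j)%:R - (i.+1 == j :> nat)%:R * x ^+ (e j - e j.-1)).
  have detU : \det U = 1.
    rewrite -det_tr det_trig.
      by apply: big1 => i _; rewrite !mxE eqxx (gtn_eqF (ltnSn i)) mul0r subr0.
    apply/is_trig_mxP => i j ltij; rewrite !mxE -val_eqE /= (gtn_eqF ltij).
    by rewrite gtn_eqF ?mul0r ?subr0 // ltnW.
  rewrite -[LHS]mulr1 -detU /gschur /divdiff_det -det_mulmx; congr (\det _).
  apply/matrixP => i j; rewrite !mxE; move: (x :: u) => v.
  transitivity (\sum_(k < m.+1) (k == j)%:R * divdiff v i 'X^(e k) -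
    \sum_(k < m.+1) (k.+1 == j :> nat)%:R * (x ^+ (e j - e j.-1) *
      divdiff v i 'X^(e k))).
    by rewrite -sumrB; apply: eq_bigr => k _; rewrite !mxE; ring.
  rewrite (bigD1 j) //= eqxx mul1r big1 ?addr0 => [|k /negPf ->];
    last by rewrite mul0r.
  case: j => [[|j] ltj] /=.
    by rewrite big1 ?subr0 // => k _; rewrite mul0r.
  rewrite (bigD1 (Ordinal (ltnW ltj))) //= eqxx mul1r big1 ?addr0 => [|k].
    by rewrite divdiffD -scaleNr divdiffZ mulNr.
  by rewrite -val_eqE /= eqSS => /negPf ->; rewrite mul0r.
have gx j : (j < m)%N -> (g j.+1).[x] = 0.
  by move=> ltj; rewrite !hornerE -exprD subnK ?subrr // ltnW // inc.
rewrite /divdiff_det (expand_det_row _ ord0) big_ord_recl big1 ?addr0 => [|j _];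
  last first.
  by rewrite mxE [divdiff _ _ _]gx ?mul0r.
rewrite mxE [divdiff _ _ _]hornerXn; congr (_ * _).
rewrite /cofactor /= expr0 mul1r -det_tr.
transitivity (\det (\matrix_(j < m, i < m)
   \sum_(k < e m) c j k * divdiff u i 'X^k)).
  congr (\det _); apply/matrixP => j i; rewrite !mxE.
  rewrite lift0 /= (@quotXsubC_binomial x (e j) (e j.+1) (e m)).
    by rewrite divdiff_sum; apply: eq_bigr => k _; rewrite divdiffZ.
  rewrite inc //=.
  exact: le_exp_last.
rewrite (det_sum_rows (fun j (k : 'I_(e m)) i => c j k * divdiff u i 'X^k)).
rewrite [RHS]big_mkcond /=; apply: eq_bigr => h _.
transitivity ((\prod_(j < m) c j (h j)) *
   gschur m u (fun j => oapp (fun i => h i : nat) 0%N (insub j))).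
  rewrite /gschur /divdiff_det -[X in _ = _ * X]det_tr.
  have -> : \prod_(j < m) c j (h j) = \det (diag_mx (\row_(j < m) c j (h j))).
    by rewrite det_diag; apply: eq_bigr => i _; rewrite mxE.
  rewrite -det_mulmx; congr (\det _); apply/matrixP => j i.
  by rewrite mul_diag_mx !mxE valK.
case: ifPn => [/forallP H|].
  by congr (_ * _); apply: eq_bigr => j _; rewrite /c H.
rewrite negb_forall => /existsP [j /negPf Hj].
by rewrite (bigD1 j) //= /c Hj !mul0r.
Qed.

(** By the branching rule all the terms are nonnegative, and the choice of the
    smallest interlacing exponents gives a positive one. *)
Lemma gschur_gt0 m u e : size u = m -> all (> 0) u ->
  (forall j, j.+1 < m -> e j < e j.+1)%N -> 0 < gschur m u e.
Proof.
elim: m u e => [|m IH] u e.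
  by move=> _ _ _; rewrite /gschur /divdiff_det det_mx00.
case: u => [//|x u] [szu] /= /andP [x0 u0] inc.
rewrite gschur_branch // mulr_gt0 ?exprn_gt0 //.
have pos (h : {ffun 'I_m -> 'I_(e m)}) :
    [forall j : 'I_m, e j <= h j < e j.+1]%N ->
    0 < (\prod_(j < m) x ^+ (e j.+1 - (h j).+1)) *
     gschur m u (fun j => oapp (fun i => h i : nat) 0%N (insub j)).
  move=> /forallP H; rewrite mulr_gt0 //.
    by apply: prodr_gt0 => j _; rewrite exprn_gt0.
  apply: IH => // j ltj; rewrite (insubT (fun k => k < m)%N ltj) /=.
  rewrite (insubT (fun k => k < m)%N (ltnW ltj)) /=.
  have /andP [H1 _] := H (Ordinal ltj).
  have /andP [_ H2] := H (Ordinal (ltnW ltj)).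
  exact: leq_trans H2 H1.
have lte (j : 'I_m) : (e j < e m)%N.
  by apply: leq_trans (inc _ _) (le_exp_last inc (ltn_ord j)); rewrite ltnS.
(* The smallest interlacing exponents. *)
pose h0 : {ffun 'I_m -> 'I_(e m)} := [ffun j => Ordinal (lte j)].
rewrite (bigD1 h0) /=; last first.
  by apply/forallP => j; rewrite ffunE /= leqnn inc ?ltnS ?ltn_ord.
rewrite ltr_wpDr ?pos //; first by apply: sumr_ge0 => h /andP [/pos/ltW].
by apply/forallP => j; rewrite ffunE /= leqnn inc ?ltnS ?ltn_ord.
Qed.
End Positivity.

(** * Polynomials with prescribed exponents and zeros *)

Section Interpolation.
Variable A : idomainType.
Implicit Types (w : seq A) (f g : {poly A}).

(** As many zeros as exponents: the coefficients solve a linear system whose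
    matrix has the Schur function as determinant. *)
Lemma span_eq0 m w e f g : size w = m -> gschur m w e != 0 ->
  in_span m e f -> f = \prod_(y <- w) ('X - y%:P) * g -> f = 0.
Proof.
move=> szw Wn0 [c Ef] Eg.
pose M : 'M[A]_m := \matrix_(i, j) divdiff w i 'X^(e j).
pose v : 'cV[A]_m := \col_j c j.
have Mv0 : M *m v = 0.
  apply/matrixP => i j; rewrite !mxE.
  have lti : (i < size w)%N by rewrite szw.
  have := divdiff_prod_lt [::] g lti; rewrite cats0 -Eg Ef divdiff_sum => E0.
  by rewrite -[RHS]E0; apply: eq_bigr => k _; rewrite !mxE divdiffZ mulrC.
have v0 : v = 0.
  apply/matrixP => i j; rewrite [RHS]mxE; apply: (mulfI Wn0).
  have : (gschur m w e *: v) i j = 0.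
    rewrite -mul_scalar_mx -[gschur _ _ _]/(\det M) -mul_adj_mx -mulmxA Mv0.
    by rewrite mulmx0 mxE.
  by rewrite [in X in X -> _]mxE mulr0.
rewrite Ef big1 // => j _; have := congr1 (fun u : 'cV[A]_m => u j 0) v0.
by rewrite !mxE => ->; rewrite scale0r.
Qed.

(** Cramer's rule without division: the top coefficient is the determinant of
    the system for the other coefficients. *)
Lemma span_vanishing m w (e : nat -> nat) D : size w =
  m -> exists c : nat -> A, exists g,
  \sum_(j < m) c j *: 'X^(e j) + gschur m w e *: 'X^D =
  \prod_(y <- w) ('X - y%:P) * g.
Proof.
move=> szw.
pose M : 'M[A]_m := \matrix_(i, j) divdiff w i 'X^(e j).
pose v : 'cV[A]_m := \col_i divdiff w i 'X^D.
pose c : 'cV[A]_m := - (\adj M *m v).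
exists (fun j => oapp (fun i => c i 0) 0 (insub j)).
set f := _ + _; have [g Eg] := newton w f; exists g; rewrite {1}Eg big1 ?add0r //.
move=> i _; have lti : (i < m)%N by rewrite -szw.
suff -> : divdiff w i f = 0 by rewrite scale0r.
rewrite divdiffD divdiffZ divdiff_sum.
have E0 : (M *m c + \det M *: v) (Ordinal lti) 0 = 0.
  by rewrite /c mulmxN mulmxA mul_mx_adj mul_scalar_mx addNr mxE.
rewrite -[RHS]E0 !mxE; congr (_ + _); apply: eq_bigr => k _.
by rewrite mxE divdiffZ valK mulrC.
Qed.

End Interpolation.

Lemma snocf_inc n (d : nat -> nat) D m :
    (forall j, j.+1 < n -> d j < d j.+1)%N -> (forall j, j < n -> d j < D)%N ->
    (m <= n.+1)%N ->
  forall j, (j.+1 < m)%N -> (snocf n d D j < snocf n d D j.+1)%N.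
Proof.
move=> d_inc dD le j lt; rewrite /snocf; have -> : (j < n)%N by lia.
by case: ifP => // lt1; [apply: d_inc | apply: dD; lia].
Qed.

(** * Two nodes with multiplicities *)

Section Nodes.
Variable R : realFieldType.
Variables (a b : R).
Hypotheses (a_gt0 : 0 < a) (ltab : a < b).

Let b_gt0 : 0 < b. Proof. exact: lt_trans ltab. Qed.

Definition nodes p q : seq R := nseq p a ++ nseq q b.
Definition schur_ab p q e := gschur (p + q) (nodes p q) e.

Lemma size_nodes p q : size (nodes p q) = (p + q)%N.
Proof. by rewrite size_cat !size_nseq. Qed.

Lemma prod_nodes p q :
  \prod_(y <- nodes p q) ('X - y%:P) = ('X - a%:P) ^+ p * ('X - b%:P) ^+ q.
Proof. by rewrite big_cat !big_nseq !iter_mulr_1. Qed.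

Lemma schur_ab_rcons_a p q m e : (p + q)%N = m ->
  gschur m.+1 (rcons (nodes p q) a) e = schur_ab p.+1 q e.
Proof.
move=> <-; apply: SchurDet.gschur_perm; first by rewrite size_nodes.
by rewrite perm_rcons.
Qed.

Lemma schur_ab_rcons_b p q m e : (p + q)%N = m ->
  gschur m.+1 (rcons (nodes p q) b) e = schur_ab p q.+1 e.
Proof.
move=> <-; rewrite /schur_ab addnS; apply: SchurDet.gschur_perm.
  by rewrite size_nodes addnS.
by rewrite perm_rcons /nodes -cat1s perm_catCA.
Qed.

Lemma schur_ab_gt0 p q e :
  (forall j, j.+1 < p + q -> e j < e j.+1)%N -> 0 < schur_ab p q e.
Proof.
move=> inc; apply: gschur_gt0 => //; first exact: size_nodes.
by rewrite all_cat !all_nseq a_gt0 b_gt0 !orbT.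
Qed.

Lemma eq_schur_ab p q e1 e2 : (forall j, (j < p + q)%N -> e1 j = e2 j) ->
  schur_ab p q e1 = schur_ab p q e2.
Proof. exact: eq_gschur. Qed.

Section Factor.
Variables (n p q : nat) (d : nat -> nat) (D D' : nat) (c c' : R).
Variables (r f g : {poly R}).
Hypotheses (pqn : (p + q)%N = n) (hr : in_span n d r).
Hypotheses (Ef : f = r + c *: 'X^D + c' *: 'X^D').
Hypotheses (Eg : f = ('X - a%:P) ^+ p * ('X - b%:P) ^+ q * g).

Lemma factor_a :
  schur_ab p q d * g.[a] = c * schur_ab p.+1 q (snocf n d D) +
    c' * schur_ab p.+1 q (snocf n d D').
Proof.
have szn : size (nodes p q) = n by rewrite size_nodes.
rewrite -!(schur_ab_rcons_a _ pqn) /schur_ab pqn;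
  apply: span_factor hr Ef _ => //.
by rewrite prod_nodes.
Qed.

Lemma factor_b :
  schur_ab p q d * g.[b] = c * schur_ab p q.+1 (snocf n d D) +
    c' * schur_ab p q.+1 (snocf n d D').
Proof.
have szn : size (nodes p q) = n by rewrite size_nodes.
rewrite -!(schur_ab_rcons_b _ pqn) /schur_ab pqn;
  apply: span_factor hr Ef _ => //.
by rewrite prod_nodes.
Qed.

End Factor.

Lemma nodes_span_eq0 n p q d f g : (p + q)%N = n -> schur_ab p q d != 0 ->
  in_span n d f -> f = ('X - a%:P) ^+ p * ('X - b%:P) ^+ q * g -> f = 0.
Proof.
move=> <- W0 hf; rewrite -prod_nodes => Ef.
exact: span_eq0 (size_nodes p q) W0 hf Ef.
Qed.

Lemma neq_ab : a != b. Proof. by rewrite lt_eqF. Qed.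

(** Powers of [X - a] and [X - b] are coprime. *)
Lemma coprime_split m l (A B : {poly R}) :
  ('X - a%:P) ^+ m * A = ('X - b%:P) ^+ l * B ->
  exists g, A = ('X - b%:P) ^+ l * g /\ B = ('X - a%:P) ^+ m * g.
Proof.
move=> E; have cop : coprimep (('X - b%:P) ^+ l) (('X - a%:P) ^+ m).
  rewrite coprimep_expl // coprimep_expr //.
  by rewrite coprimep_XsubC root_XsubC neq_ab.
have /dvdpP [g Eg] : ('X - b%:P) ^+ l %| A.
  by rewrite -(Gauss_dvdpr _ cop) E dvdp_mulr.
exists g; split; first by rewrite mulrC.
have nz : ('X - b%:P) ^+ l != 0 by rewrite expf_neq0 // polyXsubC_eq0.
by apply: (mulfI nz); rewrite -E Eg; ring.
Qed.

(** * The operator transported from the derivation *)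

(** Under [t = ab/s] and multiplication by [s^k], the operator [t d/dt] becomes
    [k - s d/ds], of eigenvalue [k - e] on [X^e]; see [euler_reversal]. *)
Definition euler k (f : {poly R}) := k%:R *: f - 'X * f^`().

Lemma euler_Xn k e : euler k 'X^e = (k%:R - e%:R) *: 'X^e.
Proof.
rewrite /euler derivXn scalerBl; congr (_ - _).
case: e => [|e]; first by rewrite mulr0n mulr0 scale0r.
by rewrite /= mulrnAr -exprS scaler_nat.
Qed.

Lemma eulerD k f g : euler k (f + g) = euler k f + euler k g.
Proof. by rewrite /euler derivD; ring. Qed.

Lemma eulerZ k c f : euler k (c *: f) = c *: euler k f.
Proof.
by rewrite /euler derivZ scalerBr !scalerA [_ * c]mulrC scalerAr.
Qed.

Lemma euler_sum k (I : Type) (r : seq I) (P : pred I) (F : I -> {poly R}) :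
  euler k (\sum_(j <- r | P j) F j) = \sum_(j <- r | P j) euler k (F j).
Proof.
apply: (big_morph _ (eulerD k)).
by have := eulerZ k 0 0; rewrite !scale0r.
Qed.

Lemma euler_span k m e f : in_span m e f -> in_span m e (euler k f).
Proof.
move=> [c ->]; exists (fun j => c j * (k%:R - (e j)%:R)).
by rewrite euler_sum; apply: eq_bigr => j _; rewrite eulerZ euler_Xn scalerA.
Qed.

Lemma euler_XsubC k c p h : euler k (('X - c%:P) ^+ p.+1 * h) =
  ('X - c%:P) ^+ p * (('X - c%:P) * euler k h - p.+1%:R *: ('X * h)).
Proof.
rewrite /euler derivM deriv_exp derivXsubC /= mul1r exprS.
rewrite -!mul_polyC -mulr_natl !polyC_natr; ring.
Qed.

(** * The exchange relation between Schur functions *)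

Section Schur.
Variables (n : nat) (d : nat -> nat).
Hypothesis (d_inc : forall j, (j.+1 < n)%N -> (d j < d j.+1)%N).

(** The Schur function of the bottom partition, in [n] variables. *)
Definition schur_low p q := schur_ab p q d.

Lemma schur_low_gt0 p q : (p + q <= n)%N -> 0 < schur_low p q.
Proof. by move=> le; apply: schur_ab_gt0 => j lt; apply/d_inc/(leq_trans lt). Qed.

Definition horner_simp := (@hornerXsubC R, @hornerD R, @hornerN R, @hornerM R,
  @hornerZ R, @hornerX R, @hornerC R, @horner_exp R).

(** Subtract from [S_low(u, b) f] the multiple of the element [Psi] of the lower
    span vanishing at [u = (a^p, b^q)] that produces one more zero at [b], and
    apply Cramer's rule at [a] to the result. *)
Lemma two_point p q (D1 D2 : nat) c1 c2 (r f g : {poly R}) :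
  (p + q).+1 = n -> in_span n d r -> f = r + c1 *: 'X^D1 + c2 *: 'X^D2 ->
  f = ('X - a%:P) ^+ p * ('X - b%:P) ^+ q * g ->
  schur_low p q.+1 * g.[a] - schur_low p.+1 q * g.[b] =
  (a - b) * (c1 * schur_ab p.+1 q.+1 (snocf n d D1) +
    c2 * schur_ab p.+1 q.+1 (snocf n d D2)).
Proof.
move=> pqn hr Ef Eg; have szw := size_nodes p q.
have S00 : schur_ab p q d != 0 by rewrite gt_eqF // schur_low_gt0 // -pqn leqnSn.
have [c [psi]] := span_vanishing d (d (p + q)%N) szw.
rewrite prod_nodes -[gschur _ _ _]/(schur_ab p q d); set Psi := _ + _ => Epsi.
have extE p1 q1 : (p1 + q1)%N =
  n -> schur_ab p1 q1 (snocf (p + q) d (d (p + q)%N)) = schur_low p1 q1.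
  move=> E; apply: eq_schur_ab => j ltj; rewrite /snocf; case: ltnP => // le.
  by congr d; lia.
have hPsi : in_span (p + q) d (\sum_(j < p + q) c j *: 'X^(d j)) by exists c.
have EPsi : Psi = \sum_(j < p + q) c j *: 'X^(d j) +
    schur_ab p q d *: 'X^(d (p + q)%N) + 0 *: 'X^0.
  by rewrite scale0r addr0.
have psia : psi.[a] = schur_low p.+1 q.
  apply: (mulfI S00); rewrite (factor_a erefl hPsi EPsi Epsi) mul0r addr0.
  by rewrite extE.
have psib : psi.[b] = schur_low p q.+1.
  apply: (mulfI S00); rewrite (factor_b erefl hPsi EPsi Epsi) mul0r addr0.
  by rewrite extE // addnS.
have spPsi : in_span n d Psi.
  exists (snocf (p + q) c (schur_ab p q d));
    rewrite -pqn big_ord_recr /= /snocf ltnn.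
  by congr (_ + _); apply: eq_bigr => j _; rewrite ltn_ord.
have /factor_theorem [h Eh] : root (schur_low p q.+1 *: g - g.[b] *: psi) b.
  by rewrite rootE !horner_simp psib mulrC subrr.
have pq' : (p + q.+1)%N = n by rewrite addnS.
have Ef' : schur_low p q.+1 *: f - g.[b] *: Psi =
  (schur_low p q.+1 *: r - g.[b] *: Psi) + (schur_low p q.+1 * c1) *: 'X^D1
    + (schur_low p q.+1 * c2) *: 'X^D2.
  by rewrite Ef !scalerDr !scalerA; ring.
have Eg' : schur_low p q.+1 *: f - g.[b] *: Psi =
  ('X - a%:P) ^+ p * ('X - b%:P) ^+ q.+1 * h.
  rewrite Epsi Eg !scalerAr -mulrBr Eh exprSr; ring.
have hr' : in_span n d (schur_low p q.+1 *: r - g.[b] *: Psi).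
  by apply: in_spanD; [|apply: in_spanN]; apply: in_spanZ.
have := factor_a pq' hr' Ef' Eg'.
rewrite -/(schur_low _ _) -!mulrA -mulrDr => /mulfI <-; last first.
  by rewrite gt_eqF // schur_low_gt0 // pq'.
have /(congr1 (fun u : {poly R} => u.[a])) := Eh.
by rewrite !horner_simp psia [RHS]mulrC => <-; ring.
Qed.

Variable D : nat.
Hypothesis (d_lt : forall j, (j < n)%N -> (d j < D.-1)%N).
Hypothesis (n_gt0 : (0 < n)%N).

(** The Schur functions of [la] and [mu] (in [n + 1] variables) and of [eta] (in
    [n + 2] variables), in terms of the lower exponents [d] and of [D]. *)
Definition schur_lam p q := schur_ab p q (snocf n d D).
Definition schur_mu p q := schur_ab p q (snocf n d D.-1).
Definition schur_eta p q := schur_ab p q (snocf n.+1 (snocf n d D.-1) D).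

Lemma schur_mu_gt0 p q : (p + q <= n.+1)%N -> 0 < schur_mu p q.
Proof. by move=> le; apply/schur_ab_gt0/(snocf_inc d_inc d_lt le). Qed.

Lemma schur_lam_gt0 p q : (p + q <= n.+1)%N -> 0 < schur_lam p q.
Proof.
by move=> le; apply/schur_ab_gt0/(snocf_inc d_inc _ le) => j /d_lt; lia.
Qed.

Lemma top_prednK : D.-1.+1 = D.
Proof. by have := d_lt n_gt0; case: D. Qed.

Lemma schur_eta_gt0 p q : (p + q <= n.+2)%N -> 0 < schur_eta p q.
Proof.
move=> le; apply: schur_ab_gt0 => j lt.
rewrite /(snocf n.+1) (_ : (j < n.+1)%N); last by lia.
case: (ltnP j.+1 n.+1) => lt1; first exact: (snocf_inc d_inc d_lt (leqnn _)).
have -> : j = n by lia.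
by rewrite /snocf ltnn; have := top_prednK; lia.
Qed.

Lemma span_snocf (c : nat -> R) D' :
  \sum_(j < n.+1) c j *: 'X^(snocf n d D' j) =
  \sum_(j < n) c j *: 'X^(d j) + c n *: 'X^D'.
Proof.
rewrite big_ord_recr /= /snocf ltnn; congr (_ + _).
by apply: eq_bigr => j _; rewrite ltn_ord.
Qed.

(** With two outer powers and [n + 1] zeros, Cramer's rule determines both outer
    coefficients: one is the determinant of the system; for the other one, move a
    zero into the cofactor, which then vanishes at that node. *)
Lemma annihilator p q : (p + q)%N = n.+1 -> exists r phi : {poly R},
  [/\ in_span n d r,
      r - schur_lam p q *: 'X^(D.-1) + schur_mu p q *: 'X^D =
        ('X - a%:P) ^+ p * ('X - b%:P) ^+ q * phi,
      phi.[a] = schur_eta p.+1 q & phi.[b] = schur_eta p q.+1].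
Proof.
move=> pqn; have szw : size (nodes p q) = n.+1 by rewrite size_nodes.
have [c [phi]] := span_vanishing (snocf n d D.-1) D szw.
rewrite prod_nodes -pqn -[gschur _ _ _]/(schur_mu p q) pqn => Ephi.
have SM0 : schur_mu p q != 0 by rewrite gt_eqF // schur_mu_gt0 ?pqn.
have cnE : c n = - schur_lam p q.
  apply: (mulfI SM0); move: Ephi; rewrite span_snocf.
  have hr : in_span n d (\sum_(j < n) c j *: 'X^(d j)) by exists c.
  case: (posnP p) => [p0|]; last case: p pqn szw SM0 => [//|p'] pqn szw SM0 _.
    case: q pqn szw SM0 => [|q']; first by rewrite p0.
    rewrite p0 add0n => -[pqn] szw SM0 Ephi.
    have Ef : \sum_(j < n) c j *: 'X^(d j) + c n *: 'X^(D.-1) +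
      schur_mu 0 q'.+1 *: 'X^D
      = ('X - a%:P) ^+ 0 * ('X - b%:P) ^+ q' * (('X - b%:P) * phi).
      by rewrite Ephi exprS; ring.
    have := factor_b (pqn : (0 + q')%N = n) hr erefl Ef.
    rewrite hornerM hornerXsubC subrr mul0r mulr0 => /esym/eqP.
    rewrite -/(schur_mu _ _) -/(schur_lam _ _).
    by rewrite mulrC -mulrDr mulf_eq0 (negPf SM0) addr_eq0 => /eqP ->;
      rewrite mulrC.
  move=> Ephi.
  have Ef : \sum_(j < n) c j *: 'X^(d j) + c n *: 'X^(D.-1) +
    schur_mu p'.+1 q *: 'X^D
    = ('X - a%:P) ^+ p' * ('X - b%:P) ^+ q * (('X - a%:P) * phi).
    by rewrite Ephi exprS; ring.
  have pq' : (p' + q)%N = n by lia.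
  have := factor_a pq' hr erefl Ef.
  rewrite hornerM hornerXsubC subrr mul0r mulr0 => /esym/eqP.
  rewrite -/(schur_mu _ _) -/(schur_lam _ _).
  by rewrite mulrC -mulrDr mulf_eq0 (negPf SM0) addr_eq0 => /eqP ->;
    rewrite mulrC.
have hr : in_span n.+1 (snocf n d D.-1)
    (\sum_(j < n.+1) c j *: 'X^(snocf n d D.-1 j)).
  by exists c.
have Ef : \sum_(j < n.+1) c j *: 'X^(snocf n d D.-1 j) + schur_mu p q *: 'X^D =
  \sum_(j < n.+1) c j *: 'X^(snocf n d D.-1 j) + schur_mu p q *: 'X^D + 0 *: 'X^0.
  by rewrite scale0r addr0.
exists (\sum_(j < n) c j *: 'X^(d j)), phi; split; first by exists c.
- by rewrite -Ephi span_snocf cnE scaleNr.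
- apply: (mulfI SM0); have := factor_a pqn hr Ef Ephi.
  by rewrite mul0r addr0.
- apply: (mulfI SM0); have := factor_b pqn hr Ef Ephi.
  by rewrite mul0r addr0.
Qed.

(** Evaluate a functional killing the lower powers on [X Phi'], [Phi] being the
    polynomial of [annihilator].  The outer coefficients [S_mu] and [- S_la] of
    [Phi] get multiplied by [D] and [D - 1], so that [S_la S_mu] is left.  On
    the other hand, [X Phi'] has lost one zero at each node, and its leading
    coefficients there involve [S_eta].  For generic nodes this is a Laplace
    expansion: [S_la S_mu] is the sum over [i] of
    [x_i S_low(x without x_i) S_eta(x, x_i)]. *)
Lemma schur_exchange p q : (p + q)%N = n.+1 ->
  p%:R * a * schur_low p.-1 q * schur_eta p.+1 q +
    q%:R * b * schur_low p q.-1 * schur_eta p q.+1 =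
  schur_lam p q * schur_mu p q.
Proof.
move=> pqn; have [r [phi [hr Ephi phia phib]]] := annihilator pqn.
set Phi := _ + _ in Ephi.
have Ef : euler 0 Phi = euler 0 r + (schur_lam p q * D.-1%:R) *: 'X^(D.-1)
    + (- schur_mu p q * D%:R) *: 'X^D.
  rewrite /Phi -scaleNr !eulerD !eulerZ !euler_Xn !scalerA !sub0r.
  by rewrite !mulNr !mulrN opprK.
have hr' := euler_span 0 hr.
have DE : D%:R = D.-1%:R + 1 :> R by rewrite -{1}top_prednK -natr1.
(* The two outer terms of the functional add up, as [D - (D - 1) = 1]. *)
have sumE : schur_lam p q * D.-1%:R * schur_mu p q +
  - schur_mu p q * D%:R * schur_lam p q = - (schur_lam p q * schur_mu p q).
  by rewrite DE; ring.
apply: oppr_inj; rewrite -sumE; clearbody Phi.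
case: p q pqn phia phib sumE {DE} Ef Ephi => [|p] [|q] //=.
- rewrite add0n => -[Eq] _ phib _ Ef Ephi.
  have Eg : euler 0 Phi = ('X - a%:P) ^+ 0 * ('X - b%:P) ^+ q *
      (('X - b%:P) * euler 0 phi - q.+1%:R *: ('X * phi)).
    by rewrite Ephi expr0 !mul1r euler_XsubC.
  have := factor_b (Eq : (0 + q)%N = n) hr' Ef Eg.
  rewrite !horner_simp subrr mul0r sub0r phib -/(schur_low _ _) -/(schur_mu _ _)
    -/(schur_lam _ _) => <-.
  ring.
- rewrite addn0 => -[Ep] phia _ _ Ef Ephi.
  have Eg : euler 0 Phi = ('X - a%:P) ^+ p * ('X - b%:P) ^+ 0 *
      (('X - a%:P) * euler 0 phi - p.+1%:R *: ('X * phi)).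
    by rewrite Ephi expr0 !mulr1 euler_XsubC.
  have Ep0 : (p + 0)%N = n by rewrite addn0.
  have := factor_a Ep0 hr' Ef Eg.
  rewrite !horner_simp subrr mul0r sub0r phia -/(schur_low _ _) -/(schur_mu _ _)
    -/(schur_lam _ _) => <-.
  ring.
move=> pqn phia phib _ Ef Ephi.
have Eg : euler 0 Phi = ('X - a%:P) ^+ p * ('X - b%:P) ^+ q *
  (('X - a%:P) * (('X - b%:P) * euler 0 phi - q.+1%:R *: ('X * phi)) -
   p.+1%:R *: ('X * ('X - b%:P) * phi)).
  rewrite Ephi -mulrA euler_XsubC euler_XsubC exprSr.
  rewrite -!mul_polyC; ring.
have pq' : (p + q).+1 = n by lia.
have := two_point pq' hr' Ef Eg.
rewrite !horner_simp !subrr !mul0r phia phib -/(schur_mu _ _) -/(schur_lam _ _)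
  => E.
have ab0 : a - b != 0 by rewrite subr_eq0 neq_ab.
apply: (mulfI ab0); rewrite -E; ring.
Qed.

End Schur.

Lemma euler_dvd k c p f :
  ('X - c%:P) ^+ p.+1 %| f -> ('X - c%:P) ^+ p %| euler k f.
Proof.
by move=> /dvdpP [h ->]; rewrite mulrC euler_XsubC dvdp_mulIl.
Qed.

(** * Closed forms for the transformed Chebyshev-Bernstein basis *)

Section Chain.
Variables (n : nat) (d : nat -> nat) (D : nat).
Hypothesis (d_inc : forall j, (j.+1 < n)%N -> (d j < d j.+1)%N).
Variables (P g : nat -> {poly R}) (kap : nat -> R).

(** The transformed basis: [kap k] is the coefficient of the top power, which
    comes from the constant function 1, and [g k] the cofactor of the zeros. *)
Definition bernstein_system :=
  [/\ forall k, (k <= n)%N ->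
        exists2 r, in_span n d r & P k = r + kap k *: 'X^D,
      forall k, (k <= n)%N ->
        P k = ('X - a%:P) ^+ (n - k) * ('X - b%:P) ^+ k * g k
    & \sum_(0 <= k < n.+1) P k = 'X^D].

Hypothesis sys : bernstein_system.

Let ST p q := schur_ab p q (snocf n d D).
Let T0 p q := schur_low d p q.

Lemma T0_gt0 p q : (p + q <= n)%N -> 0 < T0 p q.
Proof. exact: (schur_low_gt0 d_inc). Qed.

Lemma euler_system k : (k <= n)%N -> in_span n d (euler D (P k)).
Proof.
case: sys => hP _ _ /hP [r hr ->].
by rewrite eulerD eulerZ euler_Xn subrr scale0r scaler0 addr0; apply: euler_span.
Qed.

(** Applying the operator lowers the order of vanishing by one and keeps the
    leading coefficient up to the factor shown. *)
Lemma euler_lead_a p k : (p + k).+1 = n -> exists2 A,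
  A.[a] = - (p.+1%:R * a * (a - b) ^+ k * (g k).[a]) &
  euler D (P k) = ('X - a%:P) ^+ p * A.
Proof.
case: sys => _ hP _ pkn.
exists (('X - a%:P) * euler D (('X - b%:P) ^+ k * g k) -
  p.+1%:R *: ('X * (('X - b%:P) ^+ k * g k))).
  by rewrite !horner_simp; ring.
rewrite -euler_XsubC hP; last by lia.
by rewrite (_ : (n - k)%N = p.+1) ?mulrA //; lia.
Qed.

Lemma euler_lead_b p k : (p + k).+1 = n -> exists2 B,
  B.[b] = - (k.+1%:R * b * (b - a) ^+ p * (g k.+1).[b]) &
  euler D (P k.+1) = ('X - b%:P) ^+ k * B.
Proof.
case: sys => _ hP _ pkn.
exists (('X - b%:P) * euler D (('X - a%:P) ^+ p * g k.+1) -
  k.+1%:R *: ('X * (('X - a%:P) ^+ p * g k.+1))).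
  by rewrite !horner_simp; ring.
rewrite -euler_XsubC hP; last by lia.
rewrite (_ : (n - k.+1)%N = p); last by lia.
by congr (euler _ _); ring.
Qed.

(** The partial sum [Y] over [j <= k] of the images is minus the sum over
    [j > k].  The first expression gives its leading coefficient at [a], from
    [P k] alone, and the second one that at [b], from [P k.+1] alone; [two_point]
    compares them. *)
Lemma adjacent_leads p k : (p + k).+1 = n ->
  k.+1%:R * b * (g k.+1).[b] * T0 p.+1 k =
    - (p.+1%:R * a * (g k).[a] * T0 p k.+1).
Proof.
move=> pkn; have [_ hP sumP] := sys.
have [A Aa EA] := euler_lead_a pkn.
have [B Bb EB] := euler_lead_b pkn.
pose E j := euler D (P j).
have sumE : \sum_(0 <= j < n.+1) E j = 0.
  by rewrite /E -euler_sum sumP euler_Xn subrr scale0r.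
have [U EU] : exists U, \sum_(0 <= j < k) E j = ('X - a%:P) ^+ p.+1 * U.
  suff /dvdpP [U ->] : ('X - a%:P) ^+ p.+1 %| \sum_(0 <= j < k) E j.
    by exists U; rewrite mulrC.
  rewrite big_nat; apply: (big_ind (dvdp _)) => [|x y|j /andP [_ ltj]];
    first exact: dvdp0.
    exact: dvdp_add.
  apply: euler_dvd; rewrite hP; last by lia.
  by rewrite -mulrA dvdp_mulr // dvdp_exp2l //; lia.
have [V EV] : exists V, \sum_(k.+2 <= j < n.+1) E j = ('X - b%:P) ^+ k.+1 * V.
  suff /dvdpP [V ->] : ('X - b%:P) ^+ k.+1 %| \sum_(k.+2 <= j < n.+1) E j.
    by exists V; rewrite mulrC.
  rewrite big_nat; apply: (big_ind (dvdp _)) => [|x y|j /andP [gtj ltj]];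
    first exact: dvdp0.
    exact: dvdp_add.
  apply: euler_dvd; rewrite hP; last by lia.
  by rewrite mulrAC dvdp_mull // dvdp_exp2l //; lia.
(* The two expressions of the partial sum, as the sum of all images is 0. *)
have Esplit : ('X - a%:P) ^+ p * (('X - a%:P) * U + A) =
    ('X - b%:P) ^+ k * - (B + ('X - b%:P) * V).
  apply/eqP; rewrite mulrN -addr_eq0; apply/eqP; rewrite -[RHS]sumE.
  rewrite (big_cat_nat (n := k)) //=; last by lia.
  rewrite [X in _ = _ + X]big_ltn ?[X in _ = _ + (_ + X)]big_ltn; try lia.
  rewrite EU EV /E EA EB !exprS; ring.
have [G [EGa EGb]] := coprime_split Esplit.
pose Y := \sum_(0 <= j < k.+1) E j.
have EY : Y = ('X - a%:P) ^+ p * ('X - b%:P) ^+ k * G.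
  by rewrite /Y big_nat_recr //= EU /E EA -mulrA -EGa exprSr; ring.
have spY : in_span n d Y.
  rewrite /Y big_nat; apply: in_span_sum => j /andP [_ ltj].
  by apply: euler_system; lia.
have EY0 : Y = Y + 0 *: 'X^0 + 0 *: 'X^0 by rewrite scale0r !addr0.
have := two_point d_inc pkn spY EY0 EY.
rewrite !mul0r addr0 mulr0 => /eqP; rewrite subr_eq0 => /eqP EG.
have Ga : G.[a] = - (p.+1%:R * a * (g k).[a]).
  have ab0 : (a - b) ^+ k != 0 by rewrite expf_neq0 // subr_eq0 neq_ab.
  apply: (mulfI ab0); have := congr1 (fun f : {poly R} => f.[a]) EGa.
  by rewrite !horner_simp Aa subrr mul0r add0r => <-; ring.
have Gb : G.[b] = k.+1%:R * b * (g k.+1).[b].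
  have ba0 : (b - a) ^+ p != 0 by rewrite expf_neq0 // subr_eq0 eq_sym neq_ab.
  apply: (mulfI ba0); have := congr1 (fun f : {poly R} => f.[b]) EGb.
  by rewrite !horner_simp Bb subrr mul0r addr0 => <-; ring.
by rewrite -Gb /T0 mulrC -EG Ga; ring.
Qed.

Lemma lead_kap_a p k : (p + k)%N = n -> T0 p k * (g k).[a] = kap k * ST p.+1 k.
Proof.
case: sys => hT hP _ pkn; have lekn : (k <= n)%N by lia.
have [r hr Er] := hT k lekn.
have Er0 : P k = r + kap k *: 'X^D + 0 *: 'X^0 by rewrite scale0r addr0.
have Eg := hP k lekn; rewrite (_ : (n - k)%N = p) in Eg; last by lia.
by rewrite [LHS](factor_a pkn hr Er0 Eg) mul0r addr0.
Qed.

Lemma lead_kap_b p k : (p + k)%N = n -> T0 p k * (g k).[b] = kap k * ST p k.+1.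
Proof.
case: sys => hT hP _ pkn; have lekn : (k <= n)%N by lia.
have [r hr Er] := hT k lekn.
have Er0 : P k = r + kap k *: 'X^D + 0 *: 'X^0 by rewrite scale0r addr0.
have Eg := hP k lekn; rewrite (_ : (n - k)%N = p) in Eg; last by lia.
by rewrite [LHS](factor_b pkn hr Er0 Eg) mul0r addr0.
Qed.

(** Both sides are the top coefficient times the same Schur function. *)
Lemma lead_ab p k : (p + k)%N = n ->
  (g k).[a] * ST p k.+1 = (g k).[b] * ST p.+1 k.
Proof.
move=> pkn; have T0n : T0 p k != 0 by rewrite gt_eqF // T0_gt0 // pkn.
by apply: (mulfI T0n); rewrite !mulrA lead_kap_a // lead_kap_b //; ring.
Qed.

(** The constant term at 0 of the classical Bernstein polynomial of index [k] is
    this number divided by [(b - a)^n]. *)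
Definition weight k : R := 'C(n, k)%:R * (- a) ^+ k * b ^+ (n - k).

Lemma weightS p k : (p + k).+1 = n ->
  k.+1%:R * b * weight k.+1 = - (p.+1%:R * a * weight k).
Proof.
move=> pkn; rewrite /weight (_ : (n - k)%N = p.+1); last by lia.
rewrite (_ : (n - k.+1)%N = p); last by lia.
have := mul_bin_left n k; rewrite (_ : (n - k)%N = p.+1); last by lia.
move=> /(congr1 (fun m => m%:R : R)); rewrite !natrM => E.
transitivity ((k.+1%:R * 'C(n, k.+1)%:R) * b * (- a) ^+ k.+1 * b ^+ p);
  first ring.
by rewrite E !exprS; ring.
Qed.

(** Only [P 0] is nonzero at [b], where the sum of all [P k] is [b ^+ D]; this
    fixes the constant of the recurrence. *)
Definition cb_const : R := b ^+ D / (b ^+ n * (b - a) ^+ n) *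
  (ST n.+1 0 / T0 n 0).

Lemma lead_a p k : (p + k)%N = n ->
  (g k).[a] * ST p k.+1 = cb_const * weight k * T0 p k.
Proof.
elim: k p => [|k IH] p pkn.
  rewrite addn0 in pkn; subst p.
  have [_ hP sumP] := sys.
  rewrite lead_ab ?addn0 //.
  have bn0 : b ^+ n != 0 by rewrite expf_neq0 // gt_eqF.
  have ban0 : (b - a) ^+ n != 0 by rewrite expf_neq0 // subr_eq0 eq_sym neq_ab.
  have T00 : T0 n 0 != 0 by rewrite gt_eqF // T0_gt0 // addn0.
  have Eb : (b - a) ^+ n * (g 0%N).[b] = b ^+ D.
    have rest : (\sum_(1 <= j < n.+1) P j).[b] = 0.
      rewrite horner_sum big_nat big1 // => j /andP [j0 ltj].
      by rewrite hP // !horner_simp subrr expr0n (gtn_eqF j0) mulr0 mul0r.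
    have := congr1 (fun f : {poly R} => f.[b]) sumP.
    rewrite hornerXn big_ltn // hornerD rest addr0 hP // expr0 mulr1 subn0.
    by rewrite !horner_simp.
  rewrite /cb_const /weight bin0 expr0 subn0 !mul1r -Eb.
  by field; rewrite bn0 ban0 T00.
have pkn' : (p + k).+1 = n by rewrite -addnS.
have Hc := adjacent_leads pkn'; have Hw := weightS pkn'.
have IHk := IH p.+1 pkn'.
rewrite lead_ab //.
have n1 : k.+1%:R * b * T0 p.+1 k != 0.
  rewrite !mulf_neq0 ?pnatr_eq0 ?gt_eqF // T0_gt0 //; lia.
apply: (mulfI n1).
transitivity (k.+1%:R * b * (g k.+1).[b] * T0 p.+1 k * ST p.+1 k.+1); first ring.
rewrite Hc; transitivity (- (p.+1%:R * a * ((g k).[a] * ST p.+1 k.+1) *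
  T0 p k.+1)).
  by ring.
rewrite IHk.
transitivity ((- (p.+1%:R * a * weight k)) * cb_const * T0 p.+1 k * T0 p k.+1).
  by ring.
by rewrite -Hw; ring.
Qed.

Lemma lead_b p k : (p + k)%N = n ->
  (g k).[b] * ST p.+1 k = cb_const * weight k * T0 p k.
Proof. by move=> pkn; rewrite -lead_ab // lead_a. Qed.

Lemma lead_kap p k : (p + k)%N = n ->
  kap k * (ST p.+1 k * ST p k.+1) = cb_const * weight k * T0 p k ^+ 2.
Proof. by move=> pkn; rewrite mulrA -lead_kap_a // -[LHS]mulrA lead_a //;
  ring. Qed.

End Chain.

(** * The derivative formula for polynomials *)

Section DerivativeIdentity.
Variables (n : nat) (d : nat -> nat) (D : nat).
Hypothesis (d_inc : forall j, (j.+1 < n)%N -> (d j < d j.+1)%N).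
Hypothesis (d_lt : forall j, (j < n)%N -> (d j < D.-1)%N).
Hypothesis (n_gt0 : (0 < n)%N).
Variables (P g : nat -> {poly R}) (kP : nat -> R).
Variables (Q h : nat -> {poly R}) (kQ : nat -> R).
Hypothesis sysP : bernstein_system n d D P g kP.
Hypothesis sysQ : bernstein_system n d D.-1 Q h kQ.

Let T0 p q := schur_low d p q.
Let TL p q := schur_lam n d D p q.
Let TM p q := schur_mu n d D p q.
Let TE p q := schur_eta n d D p q.

(** The factors of the theorem, with [p = n - k] in place of [n]. *)
Definition gamma_val p k := T0 p k * TE p.+2 k / (TL p.+1 k * TM p.+1 k).
Definition delta_val p k := T0 p k * TE p k.+2 / (TL p k.+1 * TM p k.+1).
Definition r_val p k := TM p k.+1 * TM p.+1 k / (TE p.+1 k.+1 * T0 p k).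
Definition coef_prev p k := p.+1%:R * a * gamma_val p k * r_val p.+1 k.-1.
Definition coef_same p k :=
  r_val p k * (k.+1%:R * b * delta_val p k - p.+1%:R * a * gamma_val p k).
Definition coef_next p k := - (k.+1%:R * b * delta_val p k * r_val p.-1 k.+1).
Definition deriv_const := b * TL n.+1 0 / TM n.+1 0 / (b - a).

Let T0n p q : (p + q <= n)%N -> T0 p q != 0.
Proof. by move=> le; rewrite gt_eqF //; apply: (schur_low_gt0 d_inc). Qed.
Let TLn p q : (p + q <= n.+1)%N -> TL p q != 0.
Proof. by move=> le; rewrite gt_eqF //; apply: schur_lam_gt0 le. Qed.
Let TMn p q : (p + q <= n.+1)%N -> TM p q != 0.
Proof. by move=> le; rewrite gt_eqF //; apply: schur_mu_gt0 le. Qed.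
Let TEn p q : (p + q <= n.+2)%N -> TE p q != 0.
Proof. by move=> le; rewrite gt_eqF //; apply: schur_eta_gt0 le. Qed.

Let CP := cb_const n d D.
Let CQ := cb_const n d D.-1.

(** The ratio of the normalising constants of the two bases. *)
Lemma deriv_constE : deriv_const * CQ * (b - a) = CP.
Proof.
rewrite /deriv_const /CQ /CP /cb_const.
rewrite -/(schur_mu n d D n.+1 0) -/(schur_lam n d D n.+1 0) -/(TM _ _) -/(TL _
  _).
have -> : b ^+ D = b * b ^+ D.-1 by rewrite -exprS (top_prednK d_lt n_gt0).
rewrite -[schur_low d n 0]/(T0 n 0).
have M0 : TM n.+1 0 != 0 by rewrite TMn ?addn0.
have Z0 : T0 n 0 != 0 by rewrite T0n ?addn0.
have b0 : b ^+ n != 0 by rewrite expf_neq0 // gt_eqF.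
have ba : b - a != 0 by rewrite subr_eq0 eq_sym neq_ab.
have ban : (b - a) ^+ n != 0 by rewrite expf_neq0.
by field; rewrite M0 Z0 b0 ba ban.
Qed.

Let kQE p k : (p + k)%N = n ->
  kQ k = CQ * weight n k * T0 p k ^+ 2 / (TM p.+1 k * TM p k.+1).
Proof.
move=> pk; apply: (canRL (mulfK _)); last exact: (lead_kap d_inc sysQ pk).
by rewrite mulf_neq0 // TMn; lia.
Qed.

Let hbE p k : (p + k)%N = n -> (h k).[b] = CQ * weight n k * T0 p k / TM p.+1 k.
Proof.
move=> pk; apply: (canRL (mulfK _)); last exact: (lead_b d_inc sysQ pk).
by rewrite TMn; lia.
Qed.

Let haE p k : (p + k)%N = n -> (h k).[a] = CQ * weight n k * T0 p k / TM p k.+1.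
Proof.
move=> pk; apply: (canRL (mulfK _)); last exact: (lead_a d_inc sysQ pk).
by rewrite TMn; lia.
Qed.

Let gbE p k : (p + k)%N = n -> (g k).[b] = CP * weight n k * T0 p k / TL p.+1 k.
Proof.
move=> pk; apply: (canRL (mulfK _)); last exact: (lead_b d_inc sysP pk).
by rewrite TLn; lia.
Qed.

Let gaE p k : (p + k)%N = n -> (g k).[a] = CP * weight n k * T0 p k / TL p k.+1.
Proof.
move=> pk; apply: (canRL (mulfK _)); last exact: (lead_a d_inc sysP pk).
by rewrite TLn; lia.
Qed.

Lemma coef_prev_top p k : (p + k.+1)%N = n ->
  coef_prev p k.+1 * kQ k * (TL p.+1 k.+1 * TM p.+1 k.+1) =
  - (k.+1%:R * b * weight n k.+1 * CQ * T0 p k.+1 * T0 p.+1 k).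
Proof.
rewrite addnS => pk; rewrite (weightS pk) (kQE (pk : p.+1 + k = n)%N).
rewrite /coef_prev /gamma_val /r_val /=; field.
by rewrite !TMn ?TLn ?TEn ?T0n //; lia.
Qed.

Lemma coef_next_top p k : (p.+1 + k)%N = n ->
  coef_next p.+1 k * kQ k.+1 * (TL p.+1 k.+1 * TM p.+1 k.+1) =
  p.+1%:R * a * weight n k * CQ * T0 p.+1 k * T0 p k.+1.
Proof.
move=> pk.
transitivity (- (- (p.+1%:R * a * weight n k)) * (CQ * T0 p.+1 k * T0 p k.+1));
  last by ring.
rewrite -(weightS (pk : (p + k).+1 = n)%N).
rewrite (@kQE p k.+1) ?addnS // /coef_next /delta_val /r_val /=; field.
by rewrite !TMn ?TLn ?TEn ?T0n //; lia.
Qed.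

(** At [b] the only terms of lowest order are those of [P k.+1] and [Q k]. *)
Lemma coef_prev_lead p k : (p + k.+1)%N = n ->
  deriv_const * coef_prev p k.+1 * ((b - a) * (h k).[b]) =
    - (k.+1%:R * b * (g k.+1).[b]).
Proof.
move=> pk; rewrite (gbE pk) -deriv_constE.
transitivity (- (k.+1%:R * b * weight n k.+1) * (deriv_const * CQ * (b - a) *
  (T0 p k.+1 / TL p.+1 k.+1))); last by ring.
rewrite addnS in pk; rewrite (weightS pk) (hbE (pk : p.+1 + k = n)%N).
rewrite /coef_prev /gamma_val /r_val /=; field.
by rewrite !TMn ?TLn ?TEn ?T0n //; lia.
Qed.

(** At [a] the only terms of lowest order are those of [P k] and [Q k.+1]. *)
Lemma coef_next_lead p k : (p.+1 + k)%N = n ->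
  deriv_const * coef_next p.+1 k * ((a - b) * (h k.+1).[a]) =
    - (p.+1%:R * a * (g k).[a]).
Proof.
move=> pk; rewrite (gaE pk) -deriv_constE.
transitivity (- (p.+1%:R * a * weight n k) * (deriv_const * CQ * (b - a) *
  (T0 p.+1 k / TL p.+1 k.+1))); last by ring.
rewrite -(weightS (pk : (p + k).+1 = n)%N) (@haE p k.+1) ?addnS //.
rewrite /coef_next /delta_val /r_val /=; field.
by rewrite !TMn ?TLn ?TEn ?T0n //; lia.
Qed.

Let Qm k := if k is k'.+1 then Q k' else 0.
Let Qp k := if (k < n)%N then Q k.+1 else 0.
Let kQm k := if k is k'.+1 then kQ k' else 0.
Let kQp k := if (k < n)%N then kQ k.+1 else 0.

(** By the closed forms this is the difference of two instances of
    [schur_exchange], at [(p, k + 1)] and [(p + 1, k)], each divided by its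
    right-hand side. *)
Lemma top_coef_eq0 p k : (p + k)%N = n ->
  coef_prev p k * kQm k + coef_same p k * kQ k + coef_next p k * kQp k = 0.
Proof.
move=> pk.
have pkb : (p + k.+1)%N = n.+1 by lia.
have pka : (p.+1 + k)%N = n.+1 by lia.
have := schur_exchange d_inc d_lt n_gt0 pkb.
have := schur_exchange d_inc d_lt n_gt0 pka.
rewrite /= -/(T0 _ _) -/(T0 _ _) -/(TE _ _) -/(TE _ _) -/(TL _ _) -/(TM _ _) =>
  exa exb.
have TLa : TL p.+1 k != 0 by rewrite TLn; lia.
have TLb : TL p k.+1 != 0 by rewrite TLn; lia.
have TMa : TM p.+1 k != 0 by rewrite TMn; lia.
have TMb : TM p k.+1 != 0 by rewrite TMn; lia.
have TE0 : TE p.+1 k.+1 != 0 by rewrite TEn; lia.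
have T00 : T0 p k != 0 by rewrite T0n; lia.
have e1 : coef_prev p k * kQm k =
    - (k%:R * b * weight n k * CQ * T0 p k * T0 p.+1 k.-1) / (TL p.+1 k *
      TM p.+1 k).
  apply: (canRL (mulfK _)); first by rewrite mulf_neq0.
  rewrite /kQm; case: k pk {exa exb pka pkb TLa TLb TMa TMb TE0 T00} => [|k] pk;
    last exact: coef_prev_top.
  by rewrite !mulr0 !mul0r oppr0.
have e3 : coef_next p k * kQp k =
    p%:R * a * weight n k * CQ * T0 p k * T0 p.-1 k.+1 / (TL p k.+1 * TM p k.+1).
  apply: (canRL (mulfK _)); first by rewrite mulf_neq0.
  rewrite /kQp; case: p pk {exa exb pka pkb TLa TLb TMa TMb TE0 T00 e1} =>
    [|p] pk.
    by rewrite add0n in pk; rewrite pk ltnn !mulr0 !mul0r.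
  by rewrite (_ : (k < n)%N) ?coef_next_top //; lia.
have eA : k%:R * b * T0 p.+1 k.-1 =
    (TL p.+1 k * TM p.+1 k - p.+1%:R * a * T0 p k * TE p.+2 k) / TE p.+1 k.+1.
  by apply: (canRL (mulfK TE0)); rewrite -exa addrAC subrr add0r.
have eB : p%:R * a * T0 p.-1 k.+1 =
    (TL p k.+1 * TM p k.+1 - k.+1%:R * b * T0 p k * TE p k.+2) / TE p.+1 k.+1.
  by apply: (canRL (mulfK TE0)); rewrite -exb addrK.
have -> : coef_prev p k * kQm k = - ((k%:R * b * T0 p.+1 k.-1) *
    (weight n k * CQ * T0 p k / (TL p.+1 k * TM p.+1 k))) by rewrite e1; ring.
have -> : coef_next p k * kQp k = (p%:R * a * T0 p.-1 k.+1) *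
    (weight n k * CQ * T0 p k / (TL p k.+1 * TM p k.+1)) by rewrite e3; ring.
rewrite eA eB (kQE pk) /coef_same /gamma_val /delta_val /r_val; field.
by rewrite TLa TLb TMa TMb TE0 T00.
Qed.

(** The difference of the two sides has top coefficient 0, hence lies in the
    lower span, and it vanishes to order [p] at [a] and [k] at [b]. *)
Lemma derivative_identity p k : (p + k)%N = n ->
  euler D (P k) = deriv_const *: (coef_prev p k *: Qm k + coef_same p k *: Q k +
    coef_next p k *: Qp k).
Proof.
move=> pkn; have [hTQ hQ _] := sysQ; have [_ hP _] := sysP.
pose F := euler D (P k) - deriv_const *: (coef_prev p k *: Qm k +
  coef_same p k *: Q k + coef_next p k *: Qp k).
apply/eqP; rewrite -subr_eq0 -/F; apply/eqP.
have spF : in_span n d F.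
  have hm : exists2 r, in_span n d r & Qm k = r + kQm k *: 'X^(D.-1).
    rewrite /Qm /kQm; case: (k) pkn => [|k'] pk; last by apply: hTQ; lia.
    by exists 0; [apply: in_span0 | rewrite scale0r addr0].
  have hp : exists2 r, in_span n d r & Qp k = r + kQp k *: 'X^(D.-1).
    rewrite /Qp /kQp; case: ifP => lt; first exact: hTQ.
    by exists 0; [apply: in_span0 | rewrite scale0r addr0].
  have lekn : (k <= n)%N by lia.
  have [rm hrm Erm] := hm; have [rp hrp Erp] := hp; have [r hr Er] := hTQ k lekn.
  have -> : F = euler D (P k) - deriv_const *: (coef_prev p k *: rm +
    coef_same p k *: r + coef_next p k *: rp).
    rewrite /F Erm Erp Er; congr (_ - deriv_const *: _).
    apply/eqP; rewrite -subr_eq0; apply/eqP.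
    transitivity ((coef_prev p k * kQm k + coef_same p k * kQ k +
      coef_next p k * kQp k) *: 'X^(D.-1) : {poly R}).
      by rewrite -!mul_polyC !(polyCD, polyCM); ring.
    by rewrite top_coef_eq0 // scale0r.
  apply: in_spanD; first exact: (euler_system sysP).
  apply: in_spanN; apply: in_spanZ.
  by do 2?[apply: in_spanD]; apply: in_spanZ.
have dvda : ('X - a%:P) ^+ p %| F.
  case: p pkn @F spF => [|p] pkn F spF; first by rewrite expr0 dvd1p.
  have lt : (k < n)%N by lia.
  have [A Aa EA] := euler_lead_a sysP (pkn : (p + k).+1 = n).
  have [U EU] : exists U, Qm k = ('X - a%:P) ^+ p.+1 * U.
    rewrite /Qm; case: (k) pkn => [|k'] pk; first by exists 0; rewrite mulr0.
    exists (('X - a%:P) * (('X - b%:P) ^+ k' * h k')); rewrite hQ; last by lia.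
    by rewrite (_ : (n - k')%N = p.+2) ?exprSr; [ring | lia].
  have [V EV] : exists V, Q k = ('X - a%:P) ^+ p.+1 * V.
    exists (('X - b%:P) ^+ k * h k); rewrite hQ; last by lia.
    by rewrite (_ : (n - k)%N = p.+1) ?mulrA //; lia.
  (* The terms of order [p] at [a], whose sum vanishes to one order more. *)
  pose W := A - deriv_const *: (coef_next p.+1 k *: (('X - b%:P) ^+ k.+1 *
    h k.+1)).
  have /factor_theorem [W' EW] : root W a.
    rewrite rootE /W !horner_simp Aa; apply/eqP.
    transitivity ((- (p.+1%:R * a * (g k).[a]) -
      deriv_const * coef_next p.+1 k * ((a - b) * (h k.+1).[a])) * (a - b) ^+ k).
      by rewrite exprS; ring.
    by rewrite coef_next_lead // subrr mul0r.
  have -> : F = ('X - a%:P) ^+ p.+1 *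
      (W' - deriv_const *: (coef_prev p.+1 k *: U + coef_same p.+1 k *: V)).
    have -> : F = ('X - a%:P) ^+ p * W -
        ('X - a%:P) ^+ p.+1 * (deriv_const *: (coef_prev p.+1 k *: U +
          coef_same p.+1 k *: V)).
      rewrite /F EA EU EV /Qp lt hQ // (_ : (n - k.+1)%N = p); last by lia.
      by rewrite /W -!mul_polyC; ring.
    by rewrite EW exprSr; ring.
  exact: dvdp_mulIl.
have dvdb : ('X - b%:P) ^+ k %| F.
  case: k pkn @F spF {dvda} => [|k] pkn F spF; first by rewrite expr0 dvd1p.
  have pk : (p + k).+1 = n by rewrite -addnS.
  have [B Bb EB] := euler_lead_b sysP pk.
  have [U EU] : exists U, Qp k.+1 = ('X - b%:P) ^+ k.+1 * U.
    rewrite /Qp; case: ifP => lt; last by exists 0; rewrite mulr0.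
    exists (('X - b%:P) * (('X - a%:P) ^+ (n - k.+2) * h k.+2)).
    by rewrite hQ // [_ ^+ k.+2]exprSr; ring.
  have [V EV] : exists V, Q k.+1 = ('X - b%:P) ^+ k.+1 * V.
    exists (('X - a%:P) ^+ (n - k.+1) * h k.+1); rewrite hQ; last by lia.
    ring.
  (* The same at [b]. *)
  pose W := B - deriv_const *: (coef_prev p k.+1 *: (('X - a%:P) ^+ p.+1 * h k)).
  have /factor_theorem [W' EW] : root W b.
    rewrite rootE /W !horner_simp Bb; apply/eqP.
    transitivity ((- (k.+1%:R * b * (g k.+1).[b]) -
      deriv_const * coef_prev p k.+1 * ((b - a) * (h k).[b])) * (b - a) ^+ p).
      by rewrite exprS; ring.
    by rewrite coef_prev_lead // subrr mul0r.
  have -> : F = ('X - b%:P) ^+ k.+1 *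
      (W' - deriv_const *: (coef_next p k.+1 *: U + coef_same p k.+1 *: V)).
    have -> : F = ('X - b%:P) ^+ k * W -
        ('X - b%:P) ^+ k.+1 * (deriv_const *: (coef_next p k.+1 *: U +
          coef_same p k.+1 *: V)).
      rewrite /F EB EU EV /Qm hQ; last by lia.
      rewrite (_ : (n - k)%N = p.+1); last by lia.
      by rewrite /W -!mul_polyC; ring.
    by rewrite EW exprSr; ring.
  exact: dvdp_mulIl.
have [A EA] := dvdpP _ _ dvda; have [B EB] := dvdpP _ _ dvdb.
have [G [_ EG]] : exists G, A = ('X - b%:P) ^+ k * G /\ B = ('X - a%:P) ^+ p * G.
  by apply: coprime_split; rewrite mulrC -EA EB mulrC.
apply: (nodes_span_eq0 pkn _ spF (g := G));
  first by rewrite -/(schur_low d p k) T0n ?pkn.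
by rewrite EB EG; ring.
Qed.

End DerivativeIdentity.

End Nodes.

(** * Reversal of polynomials *)

Section Reversal.
Variable R : realFieldType.
Implicit Types (f g : {poly R}) (c s t : R).

Lemma poly_eq_pos f g : (forall t, 0 < t -> f.[t] = g.[t]) -> f = g.
Proof.
move=> E; apply/eqP; rewrite -subr_eq0; apply/eqP.
pose rs := [seq i.+1%:R : R | i <- iota 0 (size (f - g))].
apply: (@roots_geq_poly_eq0 _ _ rs); last by rewrite size_map size_iota.
- by apply/allP => _ /mapP [i _ ->];
  rewrite rootE hornerD hornerN E ?subrr ?ltr0Sn.
- rewrite map_inj_uniq ?iota_uniq // => i j /eqP.
  by rewrite eqr_nat eqSS => /eqP.
Qed.

(** Taylor's formula at [c], read in the polynomial ring. *)
Lemma dvd_of_derivn m c f : (forall j, (j < m)%N -> f^`(j).[c] = 0) ->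
  ('X - c%:P) ^+ m %| f.
Proof.
move=> H; have -> : f = (map_poly polyC f).[c%:P + ('X - c%:P)].
  by rewrite addrC subrK -[RHS]/(f \Po 'X) comp_polyXr.
rewrite nderiv_taylor; last exact: mulrC.
apply: (big_ind (dvdp _)) => [|x y|i _]; [exact: dvdp0 | exact: dvdp_add |].
case: (ltnP i m) => [lti|lemi]; last by rewrite dvdp_mull // dvdp_exp2l.
rewrite nderivn_map horner_map /= (_ : f^`N(i).[c] = 0) ?polyC0 ?mul0r ?dvdp0 //.
have := H i lti; rewrite nderivn_def hornerMn => /eqP.
by rewrite mulrn_eq0 (gtn_eqF (fact_gt0 i)) => /eqP.
Qed.

Variable q : R.

(** The polynomial [s^N f(q/s)], for [f] of degree at most [N]. *)
Definition reversal N f : {poly R} :=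
  \sum_(i < N.+1) (f`_i * q ^+ i) *: 'X^(N - i).

Lemma reversalD N f g : reversal N (f + g) = reversal N f + reversal N g.
Proof.
rewrite -big_split; apply: eq_bigr => i _.
by rewrite coefD mulrDl scalerDl.
Qed.

Lemma reversalZ N c f : reversal N (c *: f) = c *: reversal N f.
Proof.
rewrite /reversal scaler_sumr; apply: eq_bigr => i _.
by rewrite coefZ -mulrA scalerA.
Qed.

Lemma reversal_sum N (I : Type) (r : seq I) (P : pred I) (F : I -> {poly R}) :
  reversal N (\sum_(j <- r | P j) F j) = \sum_(j <- r | P j) reversal N (F j).
Proof.
apply: (big_morph _ (reversalD N)).
by have := reversalZ N 0 0; rewrite !scale0r.
Qed.

Lemma reversalXn N e : (e <= N)%N -> reversal N 'X^e = q ^+ e *: 'X^(N - e).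
Proof.
move=> le; rewrite /reversal (bigD1 (Ordinal (le : (e < N.+1)%N))) //=.
rewrite coefXn eqxx mul1r big1 ?addr0 // => i; rewrite -val_eqE /= => /negPf nie.
by rewrite coefXn nie mul0r scale0r.
Qed.

Lemma horner_reversal N f s : (size f <= N.+1)%N -> s != 0 ->
  (reversal N f).[s] = s ^+ N * f.[q / s].
Proof.
move=> szf s0; rewrite (horner_coef_wide _ szf) horner_sum mulr_sumr.
apply: eq_bigr => i _; rewrite hornerZ hornerXn expr_div_n.
have -> : s ^+ N = s ^+ i * s ^+ (N - i) by rewrite -exprD subnKC // -ltnS.
by field; rewrite expf_neq0.
Qed.

Lemma euler_reversal N f : euler N (reversal N f) = reversal N ('X * f^`()).
Proof.
rewrite /reversal euler_sum; apply: eq_bigr => -[i /= lti] _.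
rewrite eulerZ euler_Xn scalerA; congr (_ *: _).
rewrite coefXM coef_deriv natrB // opprB addrC subrK.
case: i {lti} => [|i] /=; first by rewrite mulr0n mulr0 mul0r.
by rewrite -[f`_i.+1 *+ _]mulr_natr mulrAC.
Qed.

(** The substitution exchanges the two nodes as [ab/s - a = - a (s - b)/s]. *)
Lemma reversal_factor N n a b k (G : {poly R}) : a * b = q -> 0 < a -> 0 < b ->
  (k <= n)%N -> (size G + n <= N.+1)%N ->
  reversal N (('X - a%:P) ^+ k * ('X - b%:P) ^+ (n - k) * G) =
  ('X - a%:P) ^+ (n - k) * ('X - b%:P) ^+ k *
    (((- a) ^+ k * (- b) ^+ (n - k)) *: reversal (N - n) G).
Proof.
move=> Eq a0 b0 lekn szG.
have [->|G0] := eqVneq G 0.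
  by rewrite mulr0 -(scale0r (0 : {poly R})) !reversalZ !scale0r !scaler0 mulr0.
have lenN : (n <= N)%N by rewrite -ltnS (leq_trans _ szG) // -addn1 addnC
  leq_add2r size_poly_gt0.
apply: poly_eq_pos => s s0; have sn0 : s != 0 by rewrite gt_eqF.
have szP c m : size (('X - c%:P) ^+ m : {poly R}) =
  m.+1 by rewrite size_exp_XsubC.
rewrite horner_reversal //; last first.
  rewrite -mulrA size_monicM ?monic_exp ?monicXsubC // ?mulf_neq0 //; last first.
    by rewrite expf_neq0 // polyXsubC_eq0.
  rewrite size_monicM ?monic_exp ?monicXsubC // !szP.
  by move: szG lekn; move: (size G) => m; lia.
rewrite !hornerM hornerZ !horner_exp !hornerXsubC horner_reversal //; last by lia.
have -> : s ^+ N = s ^+ k * s ^+ (n - k) * s ^+ (N - n).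
  by rewrite -!exprD; congr (_ ^+ _); lia.
have -> : q / s - a = - a * (s - b) / s by rewrite -Eq; field.
have -> : q / s - b = - b * (s - a) / s by rewrite -Eq; field.
rewrite !expr_div_n !exprMn; field.
by rewrite !expf_neq0.
Qed.

Lemma in_span_Xn m (e : nat -> nat) j : (j < m)%N ->
  in_span m e ('X^(e j) : {poly R}).
Proof.
move=> ltj; exists (fun i => (i == j)%:R).
rewrite (bigD1 (Ordinal ltj)) //= eqxx scale1r big1 ?addr0 // => i.
by rewrite -val_eqE /= => /negPf ->; rewrite scale0r.
Qed.

End Reversal.

From mathcomp Require Import all_classical all_reals all_analysis.
Import numFieldNormedType.Exports.
Local Open Scope classical_set_scope.
Local Open Scope ring_scope.

(** * From functions to polynomials *)

Section Calculus.
Variable R : realType.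
Implicit Types (f : R -> R) (p : {poly R}) (t : R).

Lemma near_pos (f g : R -> R) t : 0 < t -> (forall s, 0 < s -> f s = g s) ->
  \near t, f t = g t.
Proof.
move=> t0 fg; near=> s; apply: fg.
by near: s; apply: open_nbhs_nbhs; split; [exact: open_gt|].
Unshelve. all: end_near. Qed.

Lemma is_derive_eq_poly f p t : 0 < t -> (forall s, 0 < s -> f s = p.[s]) ->
  is_derive t (1 : R) f p^`().[t].
Proof.
move=> t0 fp; apply: (@near_eq_is_derive _ _ _ (horner p)).
by apply: near_pos => // s s0; rewrite fp.
Qed.

Lemma derive1n_eq_poly f p j : (forall s, 0 < s -> f s = p.[s]) ->
  forall t, 0 < t -> derive1n j f t = p^`(j).[t].
Proof.
move=> fp; elim: j => [|j IH] t t0; first exact: fp.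
rewrite derive1nS derivnS derive1E.
by have [_ ->] := is_derive_eq_poly t0 IH.
Qed.

Lemma vanishes_dvd m f p c : 0 < c -> (forall s, 0 < s -> f s = p.[s]) ->
  vanishes m f c -> ('X - c%:P) ^+ m %| p.
Proof.
move=> c0 fp vf; apply: dvd_of_derivn => j ltj.
by rewrite -(derive1n_eq_poly _ fp) // vf.
Qed.

End Calculus.

Section Partitions.
Implicit Types nu la : seq nat.

Lemma partition_noninc nu i j : is_partition nu -> (i <= j)%N ->
  (nth 0%N nu j <= nth 0%N nu i)%N.
Proof.
move=> nuP leij; have [ltj|gej] := ltnP j (size nu); last by rewrite nth_default.
have gtr : transitive geq by move=> x y z /= H1 H2; apply: leq_trans H2 H1.
apply: (sorted_leq_nth gtr leqnn 0 nuP) => //.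
by rewrite inE (leq_ltn_trans leij).
Qed.

End Partitions.

Section Translation.
Variables (R : realType) (a b : R).
Hypotheses (a_gt0 : 0 < a) (ltab : a < b).

(** The coefficient of the top power is that of the constant function, since
    the reversal maps the exponent 0 to the largest one. *)
Lemma muntz_system n (nu : seq nat) (d : nat -> nat) (B : 'I_n.+1 -> R -> R) :
  is_partition nu ->
  (forall j, (j < n)%N -> d j = (nth 0%N nu (n - j) + j)%N) ->
  is_chebyshev_bernstein nu a b B ->
  exists (p g : nat -> {poly R}) (kap : nat -> R),
  [/\ forall (k : 'I_n.+1) s, 0 < s -> B k s = (p k).[s],
      forall k, (size (p k) <= (nth 0%N nu 0 + n).+1)%N
    & bernstein_system a b n d (nth 0%N nu 0 + n)%N
        (fun k => reversal (a * b) (nth 0%N nu 0 + n)%N (p k)) g kap].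
Proof.
move=> nuP hd [[hB _ _] sumB vanB].
set D := (nth 0%N nu 0 + n)%N.
have b_gt0 : 0 < b by apply: lt_trans ltab.
have leD i : (i <= n)%N -> (muntz_exponent nu i <= D)%N.
  by rewrite /muntz_exponent /D; lia.
have [c hc] := choice hB.
pose pp (k : 'I_n.+1) : {poly R} :=
  \sum_(i < n.+1) c k i *: 'X^(muntz_exponent nu i).
have ppE k s : 0 < s -> B k s = (pp k).[s].
  move=> s0; rewrite hc // horner_sum; apply: eq_bigr => i _.
  by rewrite hornerZ hornerXn.
have szpp k : (size (pp k) <= D.+1)%N.
  apply: (big_ind (fun f : {poly R} => (size f <= D.+1)%N)) => [|f g hf hg|i _].
  - by rewrite size_poly0.
  - by rewrite (leq_trans (size_polyD _ _)) // geq_max hf hg.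
  - by rewrite (leq_trans (size_scale_leq _ _)) // size_polyXn ltnS leD // -ltnS.
have ppG k : exists G : {poly R},
    pp k = ('X - a%:P) ^+ k * ('X - b%:P) ^+ (n - k) * G.
  have [va vb] := vanB k.
  have /dvdpP [Ga EGa] := vanishes_dvd a_gt0 (ppE k) va.
  have /dvdpP [Gb EGb] := vanishes_dvd b_gt0 (ppE k) vb.
  have [G [EG _]] : exists G, Ga = ('X - b%:P) ^+ (n - k) * G /\
      Gb = ('X - a%:P) ^+ k * G.
    by apply: (coprime_split ltab); rewrite mulrC -EGa EGb mulrC.
  by exists G; rewrite EGa EG; ring.
have [G hG] := choice ppG.
pose tot T (x : T) (h : 'I_n.+1 -> T) (k : nat) := oapp h x (insub k).
have totE T (x : T) h (k : 'I_n.+1) : tot T x h k = h k by rewrite /tot valK.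
exists (tot _ 0 pp), (tot _ 0 (fun k => ((- a) ^+ k * (- b) ^+ (n - k)) *:
  reversal (a * b) (D - n) (G k))), (tot _ 0 (fun k => c k ord0)).
split.
- by move=> k s s0; rewrite totE ppE.
- move=> k; rewrite /tot; case: insubP => [i _ _|_] /=; first exact: szpp.
  by rewrite size_poly0.
split.
- move=> k lekn; have -> : k = Ordinal (lekn : (k < n.+1)%N) by [].
  rewrite !totE; move: (Ordinal _) => {lekn}k.
  exists (\sum_(i < n) c k (lift ord0 i) *:
    reversal (a * b) D 'X^(muntz_exponent nu (lift ord0 i))).
    apply: in_span_sum => i _; apply: in_spanZ.
    rewrite reversalXn ?(leD _ (leq_ord _)) //; apply: in_spanZ.
    have lt : (n - i.+1 < n)%N by have := ltn_ord i; lia.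
    have -> : (D - muntz_exponent nu (lift ord0 i))%N = d (n - i.+1)%N.
      have := partition_noninc nuP (leq0n i.+1); have := ltn_ord i.
      rewrite hd // /muntz_exponent /D /= /bump /= add1n => ltin le.
      rewrite (_ : (n - (n - i.+1))%N = i.+1); last by lia.
      lia.
    exact: in_span_Xn.
  rewrite reversal_sum big_ord_recl addrC; congr (_ + _).
    by apply: eq_bigr => i _; rewrite reversalZ.
  by rewrite reversalZ reversalXn ?leD // /muntz_exponent subnn /= expr0 scale1r
    subn0.
- move=> k lekn; have -> : k = Ordinal (lekn : (k < n.+1)%N) by [].
  rewrite !totE; move: (Ordinal _) => {lekn}k.
  rewrite hG reversal_factor ?leq_ord //.
  have := szpp k; rewrite hG.
  have [->|G0] := eqVneq (G k) 0; first by rewrite mulr0 size_poly0 /D; lia.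
  rewrite -mulrA size_monicM ?monic_exp ?monicXsubC // ?mulf_neq0 //; last first.
    by rewrite expf_neq0 // polyXsubC_eq0.
  rewrite size_monicM ?monic_exp ?monicXsubC // !size_exp_XsubC.
  by have := leq_ord k; move: (size (G k)) => m; lia.
- rewrite big_mkord -reversal_sum.
  under eq_bigr do rewrite totE.
  have -> : \sum_(k < n.+1) pp k = 1.
    apply: poly_eq_pos => s s0; rewrite horner_sum hornerC -(sumB s s0).
    by apply: eq_bigr => k _; rewrite ppE.
  by rewrite -[1](expr0 'X) reversalXn // expr0 scale1r subn0.
Qed.

End Translation.

(** * Exponents of the partitions involved *)

Section Exponents.

Lemma strict_exp_inc m nu j : is_partition nu -> (j.+1 < m)%N ->
  (SchurDet.strict_exp m nu j < SchurDet.strict_exp m nu j.+1)%N.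
Proof.
move=> nuP lt; rewrite /SchurDet.strict_exp addnS ltnS leq_add2r.
by apply: partition_noninc => //; lia.
Qed.

Variables (n : nat) (la : seq nat).

Definition low_exp j := (nth 0%N la (n - j) + j)%N.
Definition top_exp := (nth 0%N la 0 + n)%N.

Lemma nth_mu i : nth 0%N (mu_of la) i.+1 = nth 0%N la i.+1.
Proof. by rewrite /= nth_behead. Qed.

Lemma nth_mu0 : nth 0%N (mu_of la) 0 = (nth 0%N la 0).-1.
Proof. by rewrite /mu_of /= nth0. Qed.

Lemma strict_exp_la j : (j <= n)%N ->
  SchurDet.strict_exp n.+1 la j = snocf n low_exp top_exp j.
Proof.
move=> le; rewrite /SchurDet.strict_exp /snocf /low_exp /top_exp subSS.
by case: ltnP => // le'; rewrite (_ : j = n) ?subnn //; lia.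
Qed.

Hypothesis (laP : is_partition la).

Lemma low_exp_inc j : (j.+1 < n)%N -> (low_exp j < low_exp j.+1)%N.
Proof.
move=> lt; rewrite /low_exp addnS ltnS leq_add2r.
by apply: partition_noninc => //; lia.
Qed.

Lemma bottom_partition : is_partition (Defs.bottom la).
Proof. by rewrite /is_partition /Defs.bottom -drop1; apply: drop_sorted. Qed.

Hypothesis (la12 : (nth 0 la 1 < nth 0 la 0)%N).

Lemma low_exp_lt j : (j < n)%N -> (low_exp j < top_exp.-1)%N.
Proof.
move=> lt; rewrite /low_exp /top_exp.
by have := partition_noninc laP (_ : 1 <= n - j)%N; move: la12; lia.
Qed.

Lemma mu_partition : is_partition (mu_of la).
Proof.
move: laP la12; rewrite /is_partition /mu_of.
case: la => [//|x [//|y s]] /= /andP [_ ->] lt.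
by rewrite andbT; lia.
Qed.

Lemma eta_partition : is_partition (eta_of la).
Proof. by rewrite /is_partition /eta_of /= leqnn; exact: mu_partition. Qed.

Lemma strict_exp_mu j : (j <= n)%N ->
  SchurDet.strict_exp n.+1 (mu_of la) j = snocf n low_exp top_exp.-1 j.
Proof.
move=> le; rewrite /SchurDet.strict_exp /snocf /low_exp /top_exp subSS.
case: ltnP => le'.
  by rewrite -(ltn_predK (_ : 0 < n - j)%N) ?nth_mu //; lia.
by rewrite (_ : j = n) ?subnn ?nth_mu0; move: la12; lia.
Qed.

End Exponents.

(** * The coefficients in terms of divided differences *)

Section SchurValues.
Variables (R : realType) (a b : R).
Hypotheses (a_gt0 : 0 < a) (ltab : a < b).

Lemma schur2_schur_ab nu p q : schur2 nu a p b q =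
  schur_ab a b p q (SchurDet.strict_exp (p + q) nu).
Proof. by rewrite /schur2 SchurDet.schurE size_nodes. Qed.

Lemma ssyt_count_gt0 nu m : is_partition nu -> 0 < ssyt_count R nu m.
Proof.
move=> nuP; rewrite /ssyt_count SchurDet.schurE size_nseq.
apply: gschur_gt0; first by rewrite size_nseq.
  by rewrite all_nseq ltr01 orbT.
by move=> j; apply: strict_exp_inc.
Qed.

Lemma schur2_ssyt nu m : a ^+ (\sum_(i < m) i) * schur2 nu a m b 0 =
  a ^+ (\sum_(j < m) SchurDet.strict_exp m nu j) * ssyt_count R nu m.
Proof.
rewrite /schur2 cats0 /ssyt_count !SchurDet.schurE !size_nseq.
have <- : map ( *%R a) (nseq m 1) = nseq m a by rewrite map_nseq mulr1.
exact: gschur_scale.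
Qed.

Variables (n : nat) (la : seq nat).
Hypotheses (n_gt0 : (0 < n)%N) (laP : is_partition la).
Hypothesis (la12 : (nth 0 la 1 < nth 0 la 0)%N).

Let low := low_exp n la.
Let top := top_exp n la.

Lemma schur2_bottom p q : (p + q)%N = n ->
  schur2 (Defs.bottom la) a p b q = schur_low a b low p q.
Proof.
move=> pqn; rewrite schur2_schur_ab; apply: eq_schur_ab => j ltj.
rewrite /SchurDet.strict_exp nth_behead /low /low_exp -pqn.
by congr (nth _ _ _ + _)%N; lia.
Qed.

Lemma schur2_la p q : (p + q)%N = n.+1 ->
  schur2 la a p b q = schur_lam a b n low top p q.
Proof.
move=> pqn; rewrite schur2_schur_ab; apply: eq_schur_ab => j; rewrite pqn ltnS.
exact: strict_exp_la.
Qed.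

Lemma schur2_mu p q : (p + q)%N = n.+1 ->
  schur2 (mu_of la) a p b q = schur_mu a b n low top p q.
Proof.
move=> pqn; rewrite schur2_schur_ab; apply: eq_schur_ab => j; rewrite pqn ltnS.
exact: strict_exp_mu.
Qed.

Lemma schur2_eta p q : (p + q)%N = n.+2 ->
  schur2 (eta_of la) a p b q = schur_eta a b n low top p q.
Proof.
move=> pqn; rewrite schur2_schur_ab; apply: eq_schur_ab => j ltj.
rewrite /SchurDet.strict_exp /snocf pqn subSS.
case: (ltnP j n.+1) => lt1; last first.
  have -> : j = n.+1 by lia.
  by rewrite subnn /= /top /top_exp -nth0; move: la12; lia.
rewrite (_ : (n.+1 - j)%N = (n - j).+1); last by lia.
rewrite -[nth _ _ _.+1]/(nth 0%N (mu_of la) (n - j)) /low /low_exp.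
case: ltnP => le.
  by rewrite -(ltn_predK (_ : 0 < n - j)%N) ?nth_mu //; lia.
by rewrite (_ : j = n) ?subnn ?nth_mu0 /top /top_exp; move: la12; lia.
Qed.

(** The counts for [eta] and for the bottom partition cancel in the quotient of
    the binomials, which leaves the ratio of those for [la] and [mu]; by
    homogeneity it is, up to a power of [a], a ratio of Schur functions at
    [a^(n+1)]. *)
Lemma prefactor :
  part_binomial R (eta_of la) la n / ((b - a) *
    part_binomial R (eta_of la) (mu_of la) n)
  = deriv_const a b n low top / (a * b).
Proof.
have b_gt0 := lt_trans a_gt0 ltab.
have ba0 : b - a != 0 by rewrite subr_eq0 gt_eqF.
have sumE nu D : (forall j, (j <= n)%N ->
    SchurDet.strict_exp n.+1 nu j = snocf n low D j) ->
    \sum_(j < n.+1) SchurDet.strict_exp n.+1 nu j = (\sum_(j < n) low j + D)%N.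
  move=> E; rewrite big_ord_recr E //= /snocf ltnn; congr (_ + _)%N.
  by apply: eq_bigr => j _; rewrite E 1?ltnW // /snocf ltn_ord.
have Ela := schur2_ssyt la n.+1; have Emu := schur2_ssyt (mu_of la) n.+1.
rewrite (sumE _ _ (@strict_exp_la n la)) in Ela;
  rewrite (sumE _ _ (strict_exp_mu laP la12)) in Emu.
have n0 : (n.+1 + 0 = n.+1)%N by rewrite addn0.
rewrite (schur2_la n0) in Ela; rewrite (schur2_mu n0) in Emu.
have fla := ssyt_count_gt0 n.+1 laP;
  have fmu := ssyt_count_gt0 n.+1 (mu_partition laP la12).
have f0 := ssyt_count_gt0 n (bottom_partition laP).
have feta := ssyt_count_gt0 n.+2 (eta_partition laP la12).
have DE : (\sum_(j < n) low j + top)%N =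
    (\sum_(j < n) low j + top.-1).+1.
  by rewrite -addnS prednK // /top /top_exp addn_gt0 n_gt0 orbT.
rewrite DE in Ela.
rewrite /part_binomial /deriv_const -[Defs.bottom (eta_of la)]/(mu_of la) addn1
  addn2.
rewrite -[Defs.bottom (mu_of la)]/(Defs.bottom la).
have a0 m : a ^+ m != 0 by rewrite expf_neq0 // gt_eqF.
move: (ssyt_count R la n.+1) (ssyt_count R (mu_of la) n.+1) fla fmu Ela Emu.
move=> xl xm fla fmu.
move: (schur_lam _ _ _ _ _ _ _) (schur_mu _ _ _ _ _ _ _) => yl ym.
move: (ssyt_count R (Defs.bottom la) n) (ssyt_count R (eta_of la) n.+2) f0 feta.
move=> x0 xe f0 feta.
rewrite exprS; move: (a0 (\sum_(i < n.+1) i)%N).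
move: (a0 (\sum_(j < n) low j + top.-1)%N).
move: (a ^+ _) (a ^+ _) => z y y0 z0 Ela Emu.
have -> : yl = a * y * xl / z by rewrite -Ela mulrC mulKf.
have -> : ym = y * xm / z by rewrite -Emu mulrC mulKf.
field.
by rewrite ?(y0, z0, ba0, gt_eqF fla, gt_eqF fmu, gt_eqF f0, gt_eqF feta,
  gt_eqF a_gt0, gt_eqF b_gt0).
Qed.

Lemma GammaE k : (k <= n)%N ->
  Gamma la (eta_of la) a b n k = gamma_val a b n low top (n - k) k.
Proof.
move=> lekn; rewrite /Gamma /gamma_val.
have -> : (n + 2 - k)%N = (n - k).+2 by lia.
have -> : (n + 1 - k)%N = (n - k).+1 by lia.
congr (_ * _ / (_ * _)).
- by apply: schur2_bottom; lia.
- by apply: schur2_eta; lia.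
- by apply: schur2_la; lia.
- by apply: schur2_mu; lia.
Qed.

Lemma DeltaE k : (k <= n)%N ->
  Delta la (eta_of la) a b n k = delta_val a b n low top (n - k) k.
Proof.
move=> lekn; rewrite /Delta /delta_val !addn1 addn2.
congr (_ * _ / (_ * _)).
- by apply: schur2_bottom; lia.
- by apply: schur2_eta; lia.
- by apply: schur2_la; lia.
- by apply: schur2_mu; lia.
Qed.

Lemma RfactorE k : (k <= n)%N ->
  Rfactor (eta_of la) a b n k = r_val a b n low top (n - k) k.
Proof.
move=> lekn; rewrite /Rfactor /r_val addn1.
have -> : (n + 1 - k)%N = (n - k).+1 by lia.
congr (_ * _ / (_ * _)).
- by apply: schur2_mu; lia.
- by apply: schur2_mu; lia.
- by apply: schur2_eta; lia.
- by apply: schur2_bottom; lia.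
Qed.

End SchurValues.

(** * The derivative formula *)

Lemma size_mulX_deriv (R : realFieldType) (f : {poly R}) :
  (size ('X * f^`())%R <= size f)%N.
Proof.
have [->|f0] := eqVneq f 0; first by rewrite deriv0 mulr0.
apply: leq_trans (size_polyMleq _ _) _; rewrite size_polyX /=.
exact: lt_size_deriv.
Qed.

Theorem theorem11 (R : realType) (n : nat) (la : n.-tuple nat) (a b : R)
    (B Bmu : 'I_n.+1 -> R -> R)
    (hn : (0 < n)%N)
    (hla : is_partition la)
    (hla12 : nth 0%N la 0 <> nth 0%N la 1)
    (ha : 0 < a) (hab : a < b)
    (hB : is_chebyshev_bernstein la a b B)
    (hBmu : is_chebyshev_bernstein (mu_of la) a b Bmu)
    (k : 'I_n.+1) (t : R) (ht : 0 < t) :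
  let eta := eta_of la in
  let mu := mu_of la in
  is_derive t (1 : R) (B k)
    (part_binomial R eta la n / ((b - a) * part_binomial R eta mu n) *
     (G1 la eta a b n k * extend0 Bmu (k%:Z - 1) t +
      G2 la eta a b n k * Bmu k t +
      G3 la eta a b n k * extend0 Bmu (k%:Z + 1) t)).
Proof.
move=> eta mu; rewrite {}/eta {}/mu.
have hb : 0 < b := lt_trans ha hab.
have la12 : (nth 0 la 1 < nth 0 la 0)%N.
  by rewrite ltn_neqAle partition_noninc // andbT; apply/eqP => E; apply: hla12.
have muP := mu_partition hla la12.
pose d := low_exp n la; pose D := top_exp n la.
have d_inc := @low_exp_inc n la hla; have d_lt := @low_exp_lt n la hla la12.
have D_gt0 : (0 < D)%N by rewrite /D /top_exp addn_gt0 hn orbT.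
have [p [g [kP [hp szp sysP]]]] :=
  muntz_system (d := d) ha hab hla (fun j _ => erefl) hB.
have hd_mu j : (j < n)%N -> d j = (nth 0 (mu_of la) (n - j) + j)%N.
  by move=> lt; rewrite /d /low_exp -(ltn_predK (_ : 0 < n - j)%N) ?nth_mu //;
    lia.
have [m [h [kM [hm szm sysM]]]] := muntz_system ha hab muP hd_mu hBmu.
have DE : (nth 0 (mu_of la) 0 + n)%N = D.-1.
  by rewrite nth_mu0 /D /top_exp; move: la12; lia.
rewrite DE in sysM szm.
have lekn : (k <= n)%N by rewrite -ltnS.
have pkn : (n - k + k)%N = n by rewrite subnK.
(* The point corresponding to [t] under the substitution. *)
pose s := a * b / t.
have s0 : s != 0 by rewrite !mulf_neq0 ?invr_neq0 ?gt_eqF.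
have st : a * b / s = t.
  by rewrite /s; field; rewrite ?gt_eqF.
have := derivative_identity ha hab d_inc d_lt hn sysP sysM pkn.
rewrite -/D euler_reversal => /(congr1 (fun f : {poly R} => f.[s])).
rewrite !hornerZ !hornerD !hornerZ !horner_reversal //; last first.
  exact: leq_trans (size_mulX_deriv _) (szp k).
rewrite st hornerM hornerX.
have mE j : (j < n.+1)%N ->
    (reversal (a * b) D.-1 (m j)).[s] = s ^+ D.-1 * extend0 Bmu j%:Z t.
  move=> ltj; rewrite horner_reversal // st /extend0 insubT /=.
  by rewrite hm.
set Qprev := (X in _ * X.[s]); set Qnext := (X in _ + _ * X.[s]).
have EQprev : Qprev.[s] = s ^+ D.-1 * extend0 Bmu (k%:Z - 1) t.
  rewrite /Qprev; case: (nat_of_ord k) lekn => [|k'] lek;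
    first by rewrite horner0 mulr0.
  by rewrite mE; [rewrite -[k'.+1]addn1 PoszD addrK | lia].
have EQnext : Qnext.[s] = s ^+ D.-1 * extend0 Bmu (k%:Z + 1) t.
  rewrite /Qnext -PoszD addn1; case: (ltnP k n) => lt; first by rewrite mE.
  by rewrite horner0 /extend0 insubF ?mulr0 // ltnS ltnNge lt.
have G1E : G1 la (eta_of la) a b n k * extend0 Bmu (k%:Z - 1) t =
    coef_prev a b n d D (n - k) k * extend0 Bmu (k%:Z - 1) t.
  rewrite /G1 (GammaE ha hab hn hla la12 lekn) /coef_prev addn1 subSn //.
  case: (nat_of_ord k) lekn => [|k'] lek; first by rewrite !mulr0.
  rewrite subn1 /= (RfactorE ha hab hn hla la12 (ltnW lek)).
  by rewrite (_ : (n - k')%N = (n - k'.+1).+1) //; lia.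
have G3E : G3 la (eta_of la) a b n k * extend0 Bmu (k%:Z + 1) t =
    coef_next a b n d D (n - k) k * extend0 Bmu (k%:Z + 1) t.
  rewrite -PoszD addn1; case: (ltnP k n) => lt; last first.
    by rewrite /extend0 insubF ?mulr0 // ltnS ltnNge lt.
  rewrite /G3 (DeltaE ha hab hn hla la12 lekn) addn1.
  by rewrite (RfactorE ha hab hn hla la12 lt) /coef_next subnS.
have G2E : G2 la (eta_of la) a b n k = coef_same a b n d D (n - k) k.
  rewrite /G2 (GammaE ha hab hn hla la12 lekn) (DeltaE ha hab hn hla la12 lekn).
  by rewrite (RfactorE ha hab hn hla la12 lekn) /coef_same !addn1 subSn.
move=> E.
apply: (is_derive_eq (is_derive_eq_poly ht (hp k))).
rewrite (prefactor ha hab hn hla la12) -/d -/D G1E G2E G3E hm //.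
have sD0 : s ^+ D.-1 * (a * b) != 0.
  by rewrite mulf_neq0 ?expf_neq0 // mulf_neq0 ?gt_eqF.
apply: (mulfI sD0).
have -> : s ^+ D.-1 * (a * b) * (p k)^`().[t] = s ^+ D * (t * (p k)^`().[t]).
  by rewrite -[in RHS](prednK D_gt0) exprSr -{2}st; field.
rewrite E EQprev EQnext; field.
by rewrite !gt_eqF.
Qed.
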